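(* Let $\mathbb{F}$ be an algebraically closed field, let $\mathcal{D}\cong M_\ell(\mathbb{F})$ be a matrix algebra with the division grading $\Gamma_0:\ \mathcal{D}=\bigoplus_{t\in T}\mathbb{F}X_t$ (the generalized Pauli grading, see context), where $T$ is the support of $\Gamma_0$, and let $\beta: T\times T\to\mathbb{F}^\times$ be the nondegenerate alternating bicharacter determined by $X_uX_v=\beta(u,v)X_vX_u$ for all $u,v\in T$. Let $k\ge 1$ and let $\Gamma=\Gamma_{\mathcal{M}}(\mathcal{D},k)$ be the fine grading on $M_{k\ell}(\mathbb{F})\cong M_k(\mathbb{F})\otimes\mathcal{D}$ described in the context. Then the Weyl group of $\Gamma$ satisfies $$W(\Gamma)\cong T^{k-1}\rtimes\bigl(\mathrm{Aut}(T,\beta)\times\mathrm{Sym}(k)\bigr),$$ where $\mathrm{Aut}(T,\beta)$ and $\mathrm{Sym}(k)$ act on $T^{k-1}$ through identifying the latter with $T^k/T$, where $T$ is embedded into $T^k$ diagonally.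
   Context: Gradings and Weyl groups. A $G$-grading on an algebra $\mathcal{A}$ ($G$ an abelian group) is a vector space decomposition $\Gamma:\mathcal{A}=\bigoplus_{g\in G}\mathcal{A}_g$ with $\mathcal{A}_g\mathcal{A}_h\subset\mathcal{A}_{gh}$; its support is $S=\{g:\mathcal{A}_g\ne0\}$. $\mathrm{Aut}(\Gamma)$ is the group of all algebra automorphisms of $\mathcal{A}$ that permute the components $\mathcal{A}_s$, $s\in S$; $\mathrm{Stab}(\Gamma)$ is the subgroup of those $\varphi$ with $\varphi(\mathcal{A}_s)=\mathcal{A}_s$ for all $s\in S$. The Weyl group is $W(\Gamma)=\mathrm{Aut}(\Gamma)/\mathrm{Stab}(\Gamma)$. All algebras here are associative and finite-dimensional. Division grading. Let $T$ be a finite abelian group with a nondegenerate alternating bicharacter $\beta:T\times T\to\mathbb{F}^\times$ (multiplicative in each variable, $\beta(t,t)=1$ for all $t$, and $\beta(u,T)=1$ implies $u=e$). Then $T=(H_1'\times H_1'')\times\cdots\times(H_r'\times H_r'')$ where $H_i'=\langle a_i\rangle$ and $H_i''=\langle b_i\rangle$ are cyclic of order $\ell_i$, $\varepsilon_i=\beta(a_i,b_i)$ is a primitive $\ell_i$-th root of unity, $\beta(b_i,a_i)=\varepsilon_i^{-1}$, and all other values of $\beta$ on the elements $a_1,b_1,\dots,a_r,b_r$ are $1$. Let $\ell=\ell_1\cdots\ell_r$ and identify $M_{\ell_1}(\mathbb{F})\otimes\cdots\otimes M_{\ell_r}(\mathbb{F})$ with $M_\ell(\mathbb{F})$. Let $X_i=\mathrm{diag}(\varepsilon_i^{\ell_i-1},\dots,\varepsilon_i,1)$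 and let $Y_i$ be the $\ell_i\times\ell_i$ cyclic permutation matrix with entries $1$ in positions $(j,j+1)$, $1\le j<\ell_i$, and $(\ell_i,1)$, and $0$ elsewhere. Let $X_{a_i}$ (resp. $X_{b_i}$) be the tensor with $X_i$ (resp. $Y_i$) in the $i$-th factor and identity matrices in the other factors, and set $X_t=X_{a_1}^{i_1}X_{b_1}^{j_1}\cdots X_{a_r}^{i_r}X_{b_r}^{j_r}$ for $t=a_1^{i_1}b_1^{j_1}\cdots a_r^{i_r}b_r^{j_r}$ ($X_t$ is determined by $t$). Then $\Gamma_0: M_\ell(\mathbb{F})=\bigoplus_{t\in T}\mathbb{F}X_t$ is a grading in which every nonzero homogeneous element is invertible, and $X_uX_v=\beta(u,v)X_vX_u$. The grading $\Gamma_{\mathcal{M}}(\mathcal{D},k)$. Let $\widetilde{G}$ be the direct product of $T$ and the free abelian group (written multiplicatively) generated by symbols $\widetilde{g}_1,\dots,\widetilde{g}_k$. On $M_k(\mathcal{D})=M_k(\mathbb{F})\otimes\mathcal{D}\cong M_{k\ell}(\mathbb{F})$ with matrix units $E_{ij}\in M_k(\mathbb{F})$, the grading $\Gamma_{\mathcal{M}}(\mathcal{D},k)$ is the $\widetilde{G}$-grading determined by $\deg(E_{ij}\otimes d)=\widetilde{g}_i(\deg d)\widetilde{g}_j^{-1}$ for all nonzero homogeneous $d\in\mathcal{D}$ and $1\le i,j\le k$. $\mathrm{Aut}(T,\beta)$ is the group of automorphisms $\alpha$ of $T$ with $\beta(\alpha(u),\alpha(v))=\beta(u,v)$ for all $u,v\in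 T$; it acts on $T^k$ componentwise. $\mathrm{Sym}(k)$ is the symmetric group, acting on $T^k$ by permuting components. *)

(* Defs.v *)
From HB Require Import structures.
From mathcomp Require Import boolp classical_sets.
From mathcomp Require Import all_boot all_order all_fingroup all_algebra.
From mathcomp Require Import mxtens.

Set Implicit Arguments.
Unset Strict Implicit.
Unset Printing Implicit Defensive.

Import GRing.Theory.
Local Open Scope ring_scope.

Definition isomorphic (G H : groupType) : Prop :=
  exists f : {multiplicative G -> H}, bijective f.

(* The library only has quotients of finite groups, while the automorphism group
   of a grading is infinite in general. *)
Record normal_subgroup (G : groupType) := NormalSubgroup {
  nsub :> {pred G};
  nsub_closed : group_closed nsub;
  nsub_normal : forall x y, x \in nsub -> (x ^ y)%g \in nsub
}.

Section QuotientGroup.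
Variables (G : groupType) (N : normal_subgroup G).
Local Open Scope group_scope.
Local Open Scope quotient_scope.

Definition coset_rel : rel G := fun x y => x^-1 * y \in (N : {pred G}).

Let N1 : 1 \in (N : {pred G}). Proof. by case: (nsub_closed N). Qed.
Let NF x y : x \in (N : {pred G}) -> y \in (N : {pred G}) ->
  x * y^-1 \in (N : {pred G}).
Proof. by case: (nsub_closed N) => _; apply. Qed.
Let NV x : x \in (N : {pred G}) -> x^-1 \in (N : {pred G}).
Proof. by move=> Nx; rewrite -[x^-1]mul1g NF. Qed.
Let NM x y : x \in (N : {pred G}) -> y \in (N : {pred G}) ->
  x * y \in (N : {pred G}).
Proof. by move=> Nx Ny; rewrite -[y]invgK NF // NV. Qed.

Let coset_refl : reflexive coset_rel.
Proof. by move=> x; rewrite /coset_rel mulVg. Qed.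
Let coset_sym : symmetric coset_rel.
Proof.
move=> x y; rewrite /coset_rel; apply/idP/idP => /NV; by rewrite invgM invgK.
Qed.
Let coset_trans : transitive coset_rel.
Proof.
move=> y x z xy yz; have := NM xy yz.
by rewrite mulgA -(mulgA _ y) mulgV mulg1.
Qed.

Canonical coset_equiv := EquivRel coset_rel coset_refl coset_sym coset_trans.

Definition quotient_group := {eq_quot coset_equiv}.
HB.instance Definition _ := Choice.on quotient_group.

Definition quo_class (x : G) : quotient_group := \pi x.
Definition quo_one : quotient_group := quo_class 1.
Definition quo_mul (u v : quotient_group) := quo_class (generic_quotient.repr u * generic_quotient.repr v).
Definition quo_inv (u : quotient_group) := quo_class (generic_quotient.repr u)^-1.

Lemma quo_classP x y : reflect (quo_class x = quo_class y) (coset_rel x y).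
Proof.
by apply: (iffP idP) => [xy|/(@eqmodP _ coset_equiv)//]; apply/eqmodP.
Qed.

Lemma quo_reprK u : quo_class (generic_quotient.repr u) = u. Proof. exact: reprK. Qed.

Lemma quo_classM x y : quo_mul (quo_class x) (quo_class y) = quo_class (x * y).
Proof.
apply/quo_classP; rewrite /coset_rel.
set x' := generic_quotient.repr _; set y' := generic_quotient.repr _.
have /quo_classP Nx : quo_class x' = quo_class x by apply: quo_reprK.
have /quo_classP Ny : quo_class y' = quo_class y by apply: quo_reprK.
have -> : (x' * y')^-1 * (x * y) = (x'^-1 * x) ^ y' * (y'^-1 * y).
  by rewrite conjgE invgM !mulgA mulgK.
by apply: NM; [apply: nsub_normal | apply: Ny].
Qed.

Lemma quo_classV x : quo_inv (quo_class x) = quo_class x^-1.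
Proof.
apply/quo_classP; rewrite /coset_rel.
set x' := generic_quotient.repr _.
have /quo_classP Nx : quo_class x' = quo_class x by apply: quo_reprK.
have -> : x'^-1^-1 * x^-1 = ((x'^-1 * x) ^ x^-1)^-1.
  by rewrite conjgE !invgM !invgK !mulgA mulgV mul1g.
by apply/NV/nsub_normal.
Qed.

Lemma quo_mulA : associative quo_mul.
Proof.
move=> u v w; rewrite -[u]quo_reprK -[v]quo_reprK -[w]quo_reprK.
by rewrite !quo_classM mulgA.
Qed.
Lemma quo_mul1 : left_id quo_one quo_mul.
Proof. by move=> u; rewrite -[u]quo_reprK quo_classM mul1g. Qed.
Lemma quo_mulr1 : right_id quo_one quo_mul.
Proof. by move=> u; rewrite -[u]quo_reprK quo_classM mulg1. Qed.
Lemma quo_mulV : left_inverse quo_one quo_inv quo_mul.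
Proof. by move=> u; rewrite -[u]quo_reprK quo_classV quo_classM mulVg. Qed.
Lemma quo_mulrV : right_inverse quo_one quo_inv quo_mul.
Proof. by move=> u; rewrite -[u]quo_reprK quo_classV quo_classM mulgV. Qed.

HB.instance Definition _ := isGroup.Build quotient_group
  quo_mulA quo_mul1 quo_mulr1 quo_mulV quo_mulrV.

End QuotientGroup.

Section MatrixAlgebraAut.
Variables (F : fieldType) (n : nat).
Notation A := 'M[F]_n.

Definition is_algaut : {pred 'End(A)} :=
  fun f => `[< [/\ bijective f, f 1%:M = 1%:M &
                   forall x y : A, f (x *m y) = f x *m f y] >].

Definition algaut := {f : 'End(A) | is_algaut f}.
HB.instance Definition _ := SubType.on algaut.
HB.instance Definition _ := Choice.on algaut.

Lemma algautP (f : algaut) :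
  [/\ bijective (val f), val f 1%:M = 1%:M &
      forall x y : A, val f (x *m y) = val f x *m val f y].
Proof. exact/asboolP/(valP f). Qed.

Lemma algaut_lker0 (f : algaut) : lker (val f) == 0%VS.
Proof. by have [bf _ _] := algautP f; apply/lker0P/bij_inj. Qed.

Lemma algaut_one_proof : is_algaut \1%VF.
Proof.
apply/asboolP; split=> [||x y]; rewrite ?id_lfunE //.
by exists id => x; rewrite id_lfunE.
Qed.

Lemma algaut_mul_proof (f g : algaut) : is_algaut (val f \o val g)%VF.
Proof.
have [bf f1 fM] := algautP f; have [bg g1 gM] := algautP g.
apply/asboolP; split=> [||x y]; rewrite ?comp_lfunE ?g1 ?f1 ?gM ?fM //.
by apply: (eq_bij (bij_comp bf bg)) => x; rewrite comp_lfunE.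
Qed.

Lemma algaut_inv_proof (f : algaut) : is_algaut (val f)^-1%VF.
Proof.
have [bf f1 fM] := algautP f; have k0 := algaut_lker0 f.
have fK : cancel (val f) (val f)^-1%VF by exact: lker0_lfunK.
have fVK : cancel (val f)^-1%VF (val f) by exact: lker0_lfunVK.
apply/asboolP; split=> [||x y]; first by exists (val f).
  by rewrite -{1}f1 fK.
by apply: (bij_inj bf); rewrite fM !fVK.
Qed.

Definition algaut_one : algaut := Sub \1%VF algaut_one_proof.
Definition algaut_mul (f g : algaut) : algaut := Sub _ (algaut_mul_proof f g).
Definition algaut_inv (f : algaut) : algaut := Sub _ (algaut_inv_proof f).

Lemma algaut_mulA : associative algaut_mul.
Proof. by move=> f g h; apply/val_inj/comp_lfunA. Qed.
Lemma algaut_mul1 : left_id algaut_one algaut_mul.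
Proof. by move=> f; apply/val_inj/comp_lfun1l. Qed.
Lemma algaut_mulr1 : right_id algaut_one algaut_mul.
Proof. by move=> f; apply/val_inj/comp_lfun1r. Qed.
Lemma algaut_mulV : left_inverse algaut_one algaut_inv algaut_mul.
Proof. by move=> f; apply/val_inj/lker0_compVf/algaut_lker0. Qed.
Lemma algaut_mulrV : right_inverse algaut_one algaut_inv algaut_mul.
Proof. by move=> f; apply/val_inj/lker0_compfV/algaut_lker0. Qed.

HB.instance Definition _ := isGroup.Build algaut
  algaut_mulA algaut_mul1 algaut_mulr1 algaut_mulV algaut_mulrV.

Lemma algautME (f g : algaut) : val (f * g)%g = (val f \o val g)%VF.
Proof. by []. Qed.
Lemma algaut_img1 U : (val (1%g : algaut) @: U)%VS = U.
Proof. exact: lim1g. Qed.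
Lemma algaut_imgM (f g : algaut) U :
  (val (f * g)%g @: U)%VS = (val f @: (val g @: U))%VS.
Proof. by rewrite algautME limg_comp. Qed.
Lemma algaut_imgK (f : algaut) U : (val f^-1%g @: (val f @: U))%VS = U.
Proof. by rewrite -algaut_imgM mulVg algaut_img1. Qed.

End MatrixAlgebraAut.

Section WeylGroup.
Variables (F : fieldType) (n : nat) (G : groupType).
(* Gamma g is the component of degree g; nothing below needs the axioms of a
   grading. *)
Variable Gamma : G -> {vspace 'M[F]_n}.
Local Open Scope classical_set_scope.

Definition grading_support : set G := [set g | Gamma g != 0%VS].

Definition components : set {vspace 'M[F]_n} := Gamma @` grading_support.

(* f is bijective, so it acts injectively on subspaces: it permutes the
   components iff it maps the set of components onto itself. *)
Definition permutes_components : {pred algaut F n} :=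
  fun f => `[< (fun U => (val f @: U)%VS) @` components = components >].

Lemma permutes_closed : group_closed permutes_components.
Proof.
split.
  by apply/asboolP; apply/seteqP; split=> [U [V VG <-]|U UG];
     rewrite ?algaut_img1 //; exists U; rewrite ?algaut_img1.
move=> f g /asboolP fP /asboolP gP; apply/asboolP.
have gV : (fun U => (val g^-1%g @: U)%VS) @` components = components.
  rewrite -{1}gP; apply/seteqP; split=> [U [_ [V VG <-] <-]|U UG].
    by rewrite algaut_imgK.
  by exists (val g @: U)%VS; rewrite ?algaut_imgK //; exists U.
apply/seteqP; split=> [U [V VG <-]|U].
  rewrite algaut_imgM -fP; exists (val g^-1%g @: V)%VS => //.
  by rewrite -gV; exists V.
rewrite -{1}fP => -[V]; rewrite -{1}gV => -[W WG <-] <-.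
by exists W; rewrite ?algaut_imgM.
Qed.

Definition grading_aut := {f : algaut F n | permutes_components f}.
HB.instance Definition _ := SubType.on grading_aut.
HB.instance Definition _ := Choice.on grading_aut.
HB.instance Definition _ :=
  SubChoice_isSubGroup.Build (algaut F n) permutes_components grading_aut
    permutes_closed.

Definition in_stab : {pred grading_aut} :=
  fun f => `[< forall s, grading_support s ->
                 (val (val f) @: Gamma s)%VS = Gamma s >].

Lemma in_stab_closed : group_closed in_stab.
Proof.
split; first by apply/asboolP => s _; rewrite gmulf1 algaut_img1.
move=> f g /asboolP fP /asboolP gP; apply/asboolP => s sS.
by rewrite gmulfM gmulfV algaut_imgM -{1}(gP s sS) algaut_imgK fP.
Qed.

Lemma in_stab_normal (f g : grading_aut) :
  f \in in_stab -> (f ^ g)%g \in in_stab.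
Proof.
move=> /asboolP fP; apply/asboolP => s sS.
rewrite conjgE !gmulfM gmulfV !algaut_imgM.
have : components (val (val g) @: Gamma s)%VS.
  by rewrite -(asboolP _ (valP g)); exists (Gamma s) => //; exists s.
by case=> t tS tE; rewrite -tE fP // tE algaut_imgK.
Qed.

Definition grading_stab : normal_subgroup grading_aut :=
  NormalSubgroup in_stab_closed in_stab_normal.

Definition weyl_group : groupType := quotient_group grading_stab.
End WeylGroup.

Section Bicharacter.
Variables (F : fieldType) (T : finGroupType) (beta : T -> T -> F).
Local Open Scope group_scope.

Record alternating_bicharacter : Prop := {
  bichar_neq0 : forall u v, beta u v != 0%R;
  bicharMl : forall u v w, beta (u * v) w = (beta u w * beta v w)%R;
  bicharMr : forall u v w, beta u (v * w) = (beta u v * beta u w)%R;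
  bichar_alt : forall t, beta t t = 1%R
}.

Definition nondegenerate_bichar : Prop :=
  forall u, (forall v, beta u v = 1%R) -> u = 1.

Record symplectic_generators (r : nat) (l : 'I_r -> nat) (a b : 'I_r -> T)
    : Prop := {
  sympl_order_a : forall i, #[a i] = l i;
  sympl_order_b : forall i, #[b i] = l i;
  sympl_dprod : \big[dprod/1]_(i < r) (<[a i]> \x <[b i]>) = [set: T];
  sympl_ab : forall i, (l i).-primitive_root (beta (a i) (b i));
  sympl_ba : forall i, beta (b i) (a i) = (beta (a i) (b i))^-1%R;
  sympl_aa : forall i j, beta (a i) (a j) = 1%R;
  sympl_bb : forall i j, beta (b i) (b j) = 1%R;
  sympl_ab_neq : forall i j, i != j ->
    beta (a i) (b j) = 1%R /\ beta (b j) (a i) = 1%R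
}.

Definition bichar_aut : {set {perm T}} :=
  [set alpha in Aut [set: T] |
    [forall u, forall v, beta (alpha u) (alpha v) == beta u v]].

Lemma bichar_autP alpha : reflect
  (alpha \in Aut [set: T] /\ forall u v, beta (alpha u) (alpha v) = beta u v)
  (alpha \in bichar_aut).
Proof.
rewrite [_ \in bichar_aut]in_set; apply: (iffP andP) => -[-> aP]; split=> //.
  by move=> u v; apply/eqP/(forallP (forallP aP u)).
by apply/forallP=> u; apply/forallP=> v; apply/eqP.
Qed.

Lemma bichar_aut_group_set : group_set bichar_aut.
Proof.
apply/group_setP; split=> [|f g].
  by apply/bichar_autP; split=> [|u v]; rewrite ?group1 ?perm1.
move=> /bichar_autP[fA fP] /bichar_autP[gA gP].
by apply/bichar_autP; split=> [|u v]; rewrite ?groupM // !permM gP fP.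
Qed.
Canonical bichar_aut_group := Group bichar_aut_group_set.

End Bicharacter.

Section PauliGrading.
Variable F : fieldType.

Fixpoint tens_dim (r : nat) : ('I_r -> nat) -> nat :=
  match r with
  | 0 => fun=> 1%N
  | r'.+1 => fun l => (l ord0 * tens_dim (fun i => l (lift ord0 i)))%N
  end.

(* The Kronecker product A_0 *t (A_1 *t ...), which is the identification of the
   tensor product of the matrix algebras with a matrix algebra. *)
Fixpoint bigtens (r : nat) :
    forall l : 'I_r -> nat, (forall i, 'M[F]_(l i)) -> 'M[F]_(tens_dim l) :=
  match r with
  | 0 => fun l A => 1%:M
  | r'.+1 => fun l A => A ord0 *t bigtens (fun i => A (lift ord0 i))
  end.

Lemma tens_dimE (r : nat) (l : 'I_r -> nat) : tens_dim l = (\prod_(i < r) l i)%N.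
Proof.
by elim: r l => [|r IHr] l; rewrite ?big_ord0 // big_ord_recl /= IHr.
Qed.

(* diag(eps^(m-1), ..., eps, 1) *)
Definition clock_mx (m : nat) (eps : F) : 'M[F]_m :=
  diag_mx (\row_(j < m) eps ^+ (m.-1 - j)).

Definition shift_mx (m : nat) : 'M[F]_m :=
  \matrix_(i < m, j < m) (j == (i.+1 %% m)%N :> nat)%:R.

Variables (T : finGroupType) (beta : T -> T -> F).
Variables (r : nat) (l : 'I_r -> nat) (a b : 'I_r -> T).

Definition pauli_a (i : 'I_r) : 'M[F]_(tens_dim l) :=
  bigtens (fun j => if j == i then clock_mx (l j) (beta (a j) (b j)) else 1%:M).

Definition pauli_b (i : 'I_r) : 'M[F]_(tens_dim l) :=
  bigtens (fun j => if j == i then shift_mx (l j) else 1%:M).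

Definition pauli_exponents := {dffun forall i : 'I_r, 'I_(l i) * 'I_(l i)}.

Definition pauli_elt (e : pauli_exponents) : T :=
  (\prod_(i < r) (a i ^+ (e i).1 * b i ^+ (e i).2))%g.

Definition pauli_prod (e : pauli_exponents) : 'M[F]_(tens_dim l) :=
  \prod_(i < r) (pauli_a i ^+ (e i).1 * pauli_b i ^+ (e i).2).

(* The matrix X_t; for symplectic generators a, b, each t is pauli_elt e for
   exactly one e, and the default value 0 is not used. *)
Definition pauli_mx (t : T) : 'M[F]_(tens_dim l) :=
  if [pick e | pauli_elt e == t] is Some e then pauli_prod e else 0.

Definition pauli_grading (t : T) : {vspace 'M[F]_(tens_dim l)} :=
  <[pauli_mx t]>%VS.

End PauliGrading.

Section MatrixGrading.
Variables (F : fieldType) (n : nat) (T : finGroupType) (k : nat).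
Local Open Scope group_scope.

(* The free abelian group on k generators is Z^k, written multiplicatively. *)
Definition tilde_group : groupType :=
  (T * Algebra.to_multiplicative {ffun 'I_k -> int})%type.

Definition tilde_T (t : T) : tilde_group := (t, 1).

Definition tilde_g (i : 'I_k) : tilde_group :=
  (1, [ffun j => (j == i)%:R%R] : {ffun 'I_k -> int}).

(* The grading of M_k(D) induced by a T-grading Gamma0 of D = M_n(F), where
   M_k(D) is identified with M_(k * n)(F) by the Kronecker product. *)
Definition matrix_grading (Gamma0 : T -> {vspace 'M[F]_n}) (g : tilde_group)
    : {vspace 'M[F]_(k * n)} :=
  (\sum_(i < k) \sum_(j < k)
     \sum_(t : T | tilde_g i * tilde_T t * (tilde_g j)^-1 == g)
       (linfun (fun d => delta_mx i j *t d) @: Gamma0 t))%VS.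

End MatrixGrading.

Arguments matrix_grading {F n T} k Gamma0 g.

Section WeylAction.
Variables (F : fieldType) (T : finGroupType) (abT : abelian [set: T]).
Variables (beta : T -> T -> F) (k : nat).
Local Open Scope group_scope.

Local Notation Tpow m := {dffun forall _ : 'I_m, T}.

Definition diagonal : {set Tpow k} := [set [ffun=> t] | t : T].

Lemma diagonal_group_set : group_set diagonal.
Proof.
apply/group_setP; split=> [|_ _ /imsetP[s _ ->] /imsetP[t _ ->]].
  by apply/imsetP; exists 1 => //; apply/ffunP=> i; rewrite !ffunE.
by apply/imsetP; exists (s * t) => //; apply/ffunP=> i; rewrite !ffunE.
Qed.
Canonical diagonal_group := Group diagonal_group_set.

Definition weyl_actors : {group {perm T} * 'S_k} :=
  [group of setX (bichar_aut beta) [set: 'S_k]].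

(* Actions are right actions and permutations compose from left to right, hence
   the inverse on the permutation of the indices. *)
Definition pow_act (t : Tpow k) (x : {perm T} * 'S_k) : Tpow k :=
  [ffun i => x.1 (t (x.2^-1 i))].

Lemma pow_act_is_action : is_action weyl_actors pow_act.
Proof.
split=> [x s t /ffunP st|t x y _ _]; apply/ffunP=> i; last first.
  by rewrite !ffunE /= permM invMg permM.
by have := st (x.2 i); rewrite !ffunE permK => /perm_inj.
Qed.
Canonical pow_action := Action pow_act_is_action.

Lemma autM (x : {perm T} * 'S_k) : x \in weyl_actors -> {morph x.1 : s t / s * t}.
Proof.
by case: x => f p /setXP[] /bichar_autP[/Aut_morphic/morphicP xM _] _ s t /=; rewrite xM ?inE.
Qed.

Lemma pow_act_is_groupAction : is_groupAction [set: Tpow k] pow_action.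
Proof.
move=> x Dx; rewrite inE; apply/andP; split; first exact/subsetP.
apply/morphicP=> s t _ _; rewrite !actpermE /=; apply/ffunP=> i.
by rewrite !ffunE autM.
Qed.
Canonical pow_groupAction := GroupAction pow_act_is_groupAction.

Definition quotient_pow_act := (pow_groupAction / diagonal)%gact.

Lemma weyl_actors_qact : weyl_actors \subset qact_dom pow_groupAction diagonal.
Proof.
rewrite qact_domE ?subsetT //; apply/subsetP=> x Dx; rewrite inE Dx inE.
apply/subsetP=> _ /imsetP[t _ ->]; rewrite inE; apply/imsetP.
by exists (x.1 t) => //; apply/ffunP=> i; rewrite !ffunE.
Qed.

(* T^(k-1) is identified with T^k / T by sending (t_1, ..., t_(k-1)) to the class
   of (t_1, ..., t_(k-1), 1). *)
Definition pow_ext (t : Tpow k.-1) : Tpow k :=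
  [ffun i : 'I_k => oapp (fun j : 'I_k.-1 => t j) 1 (insub (i : nat))].

Definition pow_quo (t : Tpow k.-1) : coset_of diagonal := coset _ (pow_ext t).

Lemma Tpow_comm (s t : Tpow k) : s * t = t * s.
Proof.
by apply/ffunP=> i; rewrite !ffunE; apply: (centsP abT); rewrite inE.
Qed.

Lemma diagonal_norm (t : Tpow k) : t \in 'N(diagonal).
Proof.
rewrite inE; apply/subsetP=> _ /imsetP[s sD ->].
by rewrite /conjg Tpow_comm mulgK.
Qed.

Lemma pow_extM : {morph pow_ext : s t / s * t}.
Proof.
move=> s t; apply/ffunP=> i; rewrite !ffunE.
by case: insubP => [j _ _|_] /=; rewrite ?ffunE ?mulg1.
Qed.

Lemma pow_quoM : {morph pow_quo : s t / s * t}.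
Proof.
by move=> s t; rewrite /pow_quo pow_extM morphM ?diagonal_norm.
Qed.

Lemma pow_quo_inj : injective pow_quo.
Proof.
move=> s t /(kercoset_rcoset (diagonal_norm _) (diagonal_norm _)).
case=> _ /imsetP[c _ ->] /ffunP st; apply/ffunP=> j.
have jk : (j < k)%N by apply: leq_trans (ltn_ord j) (leq_pred k).
have k0 : (0 < k)%N by apply: leq_ltn_trans (leq0n j) jk.
have lk : (k.-1 < k)%N by rewrite prednK.
have := st (Ordinal lk); rewrite !ffunE insubF ?ltnn //= mulg1 => c1.
have := st (Ordinal jk); rewrite !ffunE -c1 mul1g.
by rewrite (insubT (fun m => (m < k.-1)%N) (ltn_ord j)) /=;
   congr (s _ = t _); apply/val_inj.
Qed.

Lemma pow_quo_surj u : exists t, pow_quo t = u.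
Proof.
have [x Nx ->] := cosetP u; case: (posnP k) => [k0|k0].
  exists 1; congr coset; apply/ffunP=> i; have := ltn_ord i.
  by rewrite {2}k0.
have lk : (k.-1 < k)%N by rewrite prednK.
have wk (j : 'I_k.-1) : (j < k)%N.
  by apply: leq_trans (ltn_ord j) (leq_pred k).
set c := x (Ordinal lk).
exists [ffun j : 'I_k.-1 => c^-1 * x (Ordinal (wk j))].
apply/(rcoset_kercosetP (diagonal_norm _) (diagonal_norm _)).
apply/rcosetP; exists [ffun=> c^-1]; first exact: imset_f.
apply/ffunP=> i; rewrite !ffunE; case: insubP => [j _ ji|] /=.
  by rewrite ffunE; congr (_ * x _); apply/val_inj.
rewrite -leqNgt => ki; suff -> : i = Ordinal lk by rewrite mulVg.
apply/val_inj/eqP; rewrite eqn_leq ki andbT -ltnS (prednK k0); apply: ltn_ord.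
Qed.

Definition pow_quo_inv (u : coset_of diagonal) : Tpow k.-1 :=
  odflt 1 [pick t | pow_quo t == u].

Lemma pow_quo_invK : cancel pow_quo_inv pow_quo.
Proof.
move=> u; rewrite /pow_quo_inv; case: pickP => [t /eqP //|] /=.
by have [t <-] := pow_quo_surj u => /(_ t); rewrite eqxx.
Qed.

Lemma pow_quoK : cancel pow_quo pow_quo_inv.
Proof. by move=> t; apply: pow_quo_inj; rewrite pow_quo_invK. Qed.

Definition weyl_act (t : Tpow k.-1) (x : {perm T} * 'S_k) : Tpow k.-1 :=
  pow_quo_inv (quotient_pow_act (pow_quo t) x).

Lemma weyl_act_is_action : is_action weyl_actors weyl_act.
Proof.
have sD := subsetP weyl_actors_qact.
split=> [x s t /(can_inj pow_quo_invK) /act_inj /pow_quo_inj //|t x y Dx Dy].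
by rewrite /weyl_act pow_quo_invK (actMin quotient_pow_act) ?sD.
Qed.
Canonical weyl_action := Action weyl_act_is_action.

Lemma weyl_act_is_groupAction : is_groupAction [set: Tpow k.-1] weyl_action.
Proof.
have sD := subsetP weyl_actors_qact.
move=> x Dx; rewrite inE; apply/andP; split; first exact/subsetP.
apply/morphicP=> s t _ _; rewrite !actpermE /=; apply: pow_quo_inj.
rewrite pow_quoM !pow_quo_invK pow_quoM.
have inQ u : pow_quo u \in [set: Tpow k]%G / diagonal.
  by apply: mem_quotient; rewrite inE.
by rewrite (gactM quotient_pow_act) ?sD.
Qed.

Definition weyl_groupAction :
    groupAction weyl_actors [set: {dffun forall _ : 'I_k.-1, T}] :=
  GroupAction weyl_act_is_groupAction.

End WeylAction.

(* Main.v *)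
Require Import Defs.
From HB Require Import structures.
From mathcomp Require Import boolp classical_sets.
From mathcomp Require Import all_boot all_order all_fingroup all_algebra.
From mathcomp Require Import mxtens.

(** Write D for the algebra with the division grading and e_i for the idempotent
    E_ii (x) 1.  The components of the grading are the lines F (E_ij (x) X_t)
    with i <> j, and the sums over i of the lines F (E_ii (x) X_t).

    Let f be an automorphism permuting the components.  The component of degree
    1 is spanned by the e_i and is the only one containing the identity, so f
    maps it onto itself and permutes its primitive idempotents by some pi
    ([permutes_idem]).  Cutting with the idempotents shows that
    f (E_ij (x) X_t) is a multiple of some E_(pi i)(pi j) (x) X_tau(i,j,t)
    ([permutes_hom_unit]).  Since f is multiplicative,
    tau(i,j,s) tau(j,m,t) = tau(i,m,st), and this forces
    tau(i,j,t) = c(pi i) alpha(t) c(pi j)^-1 with alpha an automorphism of T; it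
    preserves beta because f preserves commutation relations
    ([permutes_acts_as]).  So f has a label (alpha, pi, c), where c matters only
    modulo the diagonal of T^k ([acts_as_uniq]), and f stabilizes every component
    exactly when its label is trivial ([acts_as_stab]).

    Conversely every label occurs.  The families (X_t) and (X_alpha(t)) commute
    up to the same scalars, so the operators A |-> X_alpha(t) A X_t^-1 on D
    commute with each other; F being algebraically closed, they have a common
    eigenvector M, which is invertible because its kernel is stable under all of
    D ([twb_intertwiner]).  Conjugation by the sum of the matrices
    E_(pi i)i (x) X_c(pi i) M then has label (alpha, pi, c)
    ([acts_as_conj]).

    Permutations act on the right while automorphisms of an algebra compose as
    functions, so the label of a composite f g is the product of the label of g
    and the label of f in the semidirect product ([has_labelM]).  Sending f to
    the label of its inverse is therefore a surjective morphism whose kernel is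
    the stabilizer, and the first isomorphism theorem concludes.

    About D, the argument uses only that the X_t are invertible, commute up to
    beta, and number as many as the dimension ([twisted_basis],
    [pauli_twisted_basis]).  As beta is nondegenerate, the X_t are joint
    eigenvectors for distinct characters under conjugation by each other; hence
    they form a basis, and a matrix that commutes with all of them as X_t does
    is a multiple of X_t ([twb_homog]).  In particular X_s X_t is a multiple of
    X_st, without any computation with the explicit matrices. *)

Set Implicit Arguments.
Unset Strict Implicit.
Unset Printing Implicit Defensive.

Import GRing.Theory.
Local Open Scope ring_scope.

(** * Quotient groups *)

Section FirstIsomorphism.
Variables (G H : groupType) (N : normal_subgroup G) (phi : G -> H).
Hypothesis phiM : {morph phi : x y / (x * y)%g}.
Hypothesis ker_phi : forall x, (phi x = 1%g) <-> (x \in (N : {pred G})).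
Hypothesis phi_surj : forall y, exists x, phi x = y.

Let phi1 : phi 1%g = 1%g.
Proof. by apply/(mulgI (phi 1%g)); rewrite -phiM !mulg1. Qed.

Let phiV x : phi x^-1%g = (phi x)^-1%g.
Proof. by apply/(mulgI (phi x)); rewrite -phiM !mulgV. Qed.

Let phi_eq x y : phi x = phi y <-> quo_class N x = quo_class N y.
Proof.
split=> [xy|/quo_classP/ker_phi].
  by apply/quo_classP/ker_phi; rewrite phiM phiV xy mulVg.
by rewrite phiM phiV => xy; apply/(mulgI (phi x)^-1%g); rewrite xy mulVg.
Qed.

Let phibar (u : Defs.quotient_group N) : H := phi (generic_quotient.repr u).

Let phibarE x : phibar (quo_class N x) = phi x.
Proof. by apply/phi_eq; rewrite quo_reprK. Qed.

Let phibarM : {morph phibar : u v / (u * v)%g}.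
Proof.
move=> u v; rewrite -[RHS]phiM -[RHS]phibarE.
by congr phibar; rewrite -quo_classM !quo_reprK.
Qed.

HB.instance Definition _ :=
  isMultiplicative.Build (Defs.quotient_group N) H phibar phibarM.

Lemma first_isomorphism : isomorphic (Defs.quotient_group N) H.
Proof.
exists phibar; have [psi psiK] := choice phi_surj.
exists (fun y => quo_class N (psi y)) => [u|y] /=; last by rewrite phibarE.
by rewrite -[RHS]quo_reprK; apply/phi_eq; rewrite psiK.
Qed.

End FirstIsomorphism.

(** * Common eigenvectors of commuting matrices *)

Section CommonEigenvector.
Variable F : closedFieldType.

(** The characteristic polynomial of A splits and annihilates v; multiply v by
    its linear factors A - z one at a time, and stop just before reaching 0. *)
Lemma eigenvector_in_orbit n (A : 'M[F]_n.+1) (v : 'rV_n.+1) : v != 0 ->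
  exists p : {poly F}, v *m horner_mx A p != 0 /\
    exists a, v *m horner_mx A p *m A = a *: (v *m horner_mx A p).
Proof.
move=> v0; have [s sE] := closed_field_poly_normal (char_poly A).
have : v *m horner_mx A (\prod_(z <- s) ('X - z%:P)) = 0.
  have := Cayley_Hamilton A; rewrite sE linearZ /= (monicP (char_poly_monic A)).
  by rewrite scale1r => ->; rewrite mulmx0.
elim: s {sE} => [|z s IHs].
  by rewrite big_nil rmorph1 mulmx1 => /eqP; rewrite (negPf v0).
have [s0 _|s1] := eqVneq (v *m horner_mx A (\prod_(z <- s) ('X - z%:P))) 0.
  exact: IHs.
rewrite big_cons mulrC rmorphM /= rmorphB /= horner_mx_X horner_mx_C.
rewrite -mulmxE mulmxA mulmxBr mul_mx_scalar => /eqP; rewrite subr_eq0.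
by move=> /eqP Az; eexists; split; first exact: s1; exists z.
Qed.

(** A polynomial in A maps a common eigenvector of matrices commuting with A to
    a vector that is zero or again an eigenvector of each of them, so
    [eigenvector_in_orbit] adds one matrix at a time to the list. *)
Lemma comm_eigenvector n (As : seq 'M[F]_n) :
  (0 < n)%N -> {in As &, forall A B, A *m B = B *m A} ->
  exists2 v : 'rV_n, v != 0 & forall A, A \in As -> exists a, v *m A = a *: v.
Proof.
case: n As => // n As _; elim: As => [|A As IHs] cAs.
  by exists (const_mx 1) => //; apply/eqP => /rowP /(_ ord0) /eqP;
     rewrite !mxE oner_eq0.
have [|v v0 vP] := IHs.
  by move=> B C BA CA; apply: cAs; rewrite inE ?BA ?CA orbT.
have [p [pv0 [a pvA]]] := eigenvector_in_orbit A v0.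
exists (v *m horner_mx A p) => // B; rewrite inE => /predU1P[->|BAs].
  by exists a.
have [b vB] := vP B BAs; exists b.
have cBA : comm_mx B A by apply: cAs; rewrite !inE ?eqxx ?BAs ?orbT.
by rewrite -mulmxA -(comm_mx_horner p cBA) mulmxA vB scalemxAl.
Qed.

End CommonEigenvector.

(** * Families of matrices commuting up to a bicharacter *)

(** Abstracts the homogeneous basis of a division grading.  When beta is a
    nondegenerate alternating bicharacter, these properties force the X_t to be
    a basis ([twb_span]) and X_s X_t to be a multiple of X_st ([twb_homogM]). *)
Record twisted_basis (F : fieldType) (T : finGroupType) (beta : T -> T -> F)
    n (X : T -> 'M[F]_n) : Prop := {
  twb_unit : forall t, X t \in unitmx;
  twb_comm : forall u v, X u *m X v = beta u v *: (X v *m X u);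
  twb_card : #|T| = (n * n)%N
}.

Section TwistedBasis.
Variables (F : fieldType) (T : finGroupType) (beta : T -> T -> F).
Hypothesis beta_bichar : alternating_bicharacter beta.
Hypothesis beta_nondeg : nondegenerate_bichar beta.
Variables (n : nat) (X : T -> 'M[F]_n).
Hypothesis Xtw : twisted_basis beta X.

Let Xunit := twb_unit Xtw.
Let betaMl := bicharMl beta_bichar.
Let betaMr := bicharMr beta_bichar.
Let beta0 := bichar_neq0 beta_bichar.

Lemma bichar1l v : beta 1%g v = 1.
Proof.
by apply: (mulfI (beta0 1%g v)); rewrite -betaMl mulg1 mulr1.
Qed.

Lemma bichar1r u : beta u 1%g = 1.
Proof.
by apply: (mulfI (beta0 u 1%g)); rewrite -betaMr mulg1 mulr1.
Qed.

Lemma bicharVl u v : beta u^-1%g v = (beta u v)^-1.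
Proof.
by apply: (mulfI (beta0 u v)); rewrite -betaMl !mulgV bichar1l mulfV ?beta0.
Qed.

Lemma bicharVr u v : beta u v^-1%g = (beta u v)^-1.
Proof.
by apply: (mulfI (beta0 u v)); rewrite -betaMr !mulgV bichar1r mulfV ?beta0.
Qed.

Lemma bichar_sym u v : beta v u = (beta u v)^-1.
Proof.
apply: (mulfI (beta0 u v)); rewrite mulfV ?beta0 //.
have := bichar_alt beta_bichar (u * v)%g.
by rewrite betaMl !betaMr !(bichar_alt beta_bichar) mul1r mulr1.
Qed.

(** Nondegeneracy, read as the injectivity of t |-> beta(-, t). *)
Lemma bichar_separates s t : (forall u, beta u s = beta u t) -> s = t.
Proof.
move=> st; apply/(mulgI t^-1%g); rewrite mulVg; apply: beta_nondeg => u.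
rewrite betaMl bicharVl (bichar_sym u s) (bichar_sym u t) st.
by rewrite mulVf ?invr_eq0.
Qed.

Lemma twb_dim_gt0 : (0 < n)%N.
Proof.
by have := cardG_gt0 [set: T]; rewrite cardsT (twb_card Xtw) muln_gt0 andbb.
Qed.

Lemma unitmx_neq0 (A : 'M[F]_n) : A \in unitmx -> A != 0.
Proof.
move=> Au; apply/eqP => A0; have := mulVmx Au; rewrite A0 mulmx0.
move=> /matrixP/(_ (Ordinal twb_dim_gt0) (Ordinal twb_dim_gt0)) /eqP.
by rewrite !mxE eqxx eq_sym oner_eq0.
Qed.

Lemma twb_conj u t : X u *m X t *m invmx (X u) = beta u t *: X t.
Proof. by rewrite (twb_comm Xtw) -scalemxAl mulmxK. Qed.

(** The X_t are joint eigenvectors of the conjugations by the X_u, with distinct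
    characters.  As for distinct eigenvalues, subtract beta(u,s) times a relation
    from its conjugate by X_u to shorten it. *)
Lemma twb_lindep (S : {set T}) (c : T -> F) :
  \sum_(t in S) c t *: X t = 0 -> {in S, forall t, c t = 0}.
Proof.
have [m] := ubnP #|S|; elim: m S c => // m IHm S c Sm sum0 s sS.
have cst t : t \in S -> t != s -> c t = 0.
  move=> tS ts; apply/eqP; apply: contraTT (ts) => ct; rewrite negbK; apply/eqP.
  apply: bichar_separates => u; apply/eqP; rewrite -subr_eq0.
  have : c t * (beta u t - beta u s) = 0.
    apply: (IHm (S :\ s) (fun t => c t * (beta u t - beta u s))).
    - by move: Sm; rewrite (cardsD1 s) sS.
    - transitivity (\sum_(t in S) (c t * (beta u t - beta u s)) *: X t).
        by rewrite [RHS](big_setD1 s) //= subrr mulr0 scale0r add0r.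
      transitivity (X u *m (\sum_(t in S) c t *: X t) *m invmx (X u)
                    - beta u s *: (\sum_(t in S) c t *: X t)).
        rewrite mulmx_sumr mulmx_suml scaler_sumr -sumrB.
        apply: eq_bigr => v _; rewrite -scalemxAr -scalemxAl twb_conj.
        by rewrite !scalerA -scalerBl mulrBr [beta u s * _]mulrC.
      by rewrite sum0 mulmx0 mul0mx scaler0 subrr.
    - by rewrite !inE ts tS.
  by move=> /eqP; rewrite mulf_eq0 (negPf ct).
move: sum0; rewrite (big_setD1 s) //= big1 => [|t]; last first.
  by rewrite !inE => /andP[ts tS]; rewrite cst ?scale0r.
rewrite addr0 => /eqP; rewrite scaler_eq0 (negPf (unitmx_neq0 (Xunit s))) orbF.
by move/eqP.
Qed.

Lemma twb_span (A : 'M[F]_n) : exists c : T -> F, A = \sum_t c t *: X t.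
Proof.
pose B := [tuple X (enum_val i) | i < #|T|].
have BE (i : 'I_#|T|) : B`_i = X (enum_val i) by rewrite nth_mktuple.
have Bbasis : basis_of fullv B.
  have dimB : (\dim (fullv : {vspace 'M[F]_n}) <= size B)%N.
    by rewrite size_tuple dimvf dim_matrix (twb_card Xtw).
  rewrite basisEfree subvf dimB !andbT; apply/freeP => k k0 i.
  have := @twb_lindep setT (fun t => k (enum_rank t)).
  rewrite (reindex_onto enum_val enum_rank) => [|t _]; last exact: enum_rankK.
  rewrite (eq_big predT (fun i => k i *: B`_i)) => [/(_ k0 (enum_val i))|j|j _].
  - by rewrite enum_valK inE; apply.
  - by rewrite inE enum_valK eqxx.
  - by rewrite enum_valK BE.
exists (fun t => coord B (enum_rank t) A).
rewrite [LHS](coord_basis Bbasis (memvf A)).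
rewrite [RHS](reindex_onto enum_val enum_rank) => [|t _]; last first.
  exact: enum_rankK.
apply: eq_big => [j|j _]; first by rewrite enum_valK eqxx.
by rewrite enum_valK BE.
Qed.

(** In the expansion of A in the basis, the coefficients at s <> t vanish,
    because some X_u conjugates X_s and A by different scalars. *)
Lemma twb_homog (A : 'M[F]_n) t :
  (forall u, X u *m A = beta u t *: (A *m X u)) -> A \in <[X t]>%VS.
Proof.
have [c AE] := twb_span A => At; apply/vlineP; exists (c t).
rewrite {1}AE (bigD1 t) //= big1 ?addr0 // => s st.
suff -> : c s = 0 by rewrite scale0r.
apply/eqP; apply: contraTT st => cs; rewrite negbK; apply/eqP.
apply: bichar_separates => u; apply/eqP; rewrite -subr_eq0.
have : c s * (beta u s - beta u t) = 0.
  apply: (@twb_lindep setT (fun s => c s * (beta u s - beta u t))) => //.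
  transitivity (X u *m A *m invmx (X u) - beta u t *: A); last first.
    by rewrite At -scalemxAl mulmxK // subrr.
  rewrite AE mulmx_sumr mulmx_suml scaler_sumr -sumrB.
  apply: eq_big => [v|v _]; first by rewrite inE.
  rewrite -scalemxAr -scalemxAl twb_conj.
  by rewrite !scalerA -scalerBl mulrBr [beta u t * _]mulrC.
by move=> /eqP; rewrite mulf_eq0 (negPf cs).
Qed.

Lemma twb_homog_comm (A : 'M[F]_n) t u : A \in <[X t]>%VS ->
  X u *m A = beta u t *: (A *m X u).
Proof.
case/vlineP => c ->.
by rewrite -scalemxAr -scalemxAl [in LHS](twb_comm Xtw) !scalerA mulrC.
Qed.

Lemma twb_homogM (A B : 'M[F]_n) s t :
  A \in <[X s]>%VS -> B \in <[X t]>%VS -> A *m B \in <[X (s * t)%g]>%VS.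
Proof.
move=> As Bt; apply: twb_homog => u.
rewrite mulmxA (twb_homog_comm u As) -scalemxAl -mulmxA (twb_homog_comm u Bt).
by rewrite -scalemxAr scalerA mulmxA betaMr.
Qed.

Lemma twb_homog1 : (1%:M : 'M[F]_n) \in <[X 1%g]>%VS.
Proof. by apply: twb_homog => u; rewrite bichar1r scale1r mulmx1 mul1mx. Qed.

Lemma twb_homogV (A : 'M[F]_n) t :
  A \in unitmx -> A \in <[X t]>%VS -> invmx A \in <[X t^-1%g]>%VS.
Proof.
move=> Au At; apply: twb_homog => u.
have -> : X u *m invmx A = invmx A *m (A *m X u) *m invmx A.
  by rewrite mulmxA mulVmx // mul1mx.
have -> : A *m X u = (beta u t)^-1 *: (X u *m A).
  by rewrite (twb_homog_comm u At) scalerA mulVf ?scale1r.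
by rewrite bicharVr -scalemxAr -scalemxAl -!mulmxA mulmxV // mulmx1.
Qed.

Lemma twb_line_inj s t : X s \in <[X t]>%VS -> s = t.
Proof.
move=> st; apply: bichar_separates => u.
have := twb_homog_comm u st; rewrite (twb_comm Xtw) => /eqP.
rewrite -subr_eq0 -scalerBl scaler_eq0 subr_eq0 => /orP[/eqP //|].
by rewrite (negPf (unitmx_neq0 _)) // unitmx_mul !Xunit.
Qed.

End TwistedBasis.

Section Intertwiner.
Variables (F : closedFieldType) (T : finGroupType) (beta : T -> T -> F).
Hypothesis beta_bichar : alternating_bicharacter beta.
Hypothesis beta_nondeg : nondegenerate_bichar beta.
Variables (n : nat) (X Y : T -> 'M[F]_n).
Hypothesis Xtw : twisted_basis beta X.
Hypothesis Ytw : twisted_basis beta Y.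

Let Z t : {linear 'M[F]_n -> 'M[F]_n} := mulmx (Y t) \o mulmxr (invmx (X t)).

Let ZC s t A : Z s (Z t A) = Z t (Z s A).
Proof.
have Xu := twb_unit Xtw; have beta1 u v : beta u v * beta v u = 1.
  by rewrite (bichar_sym beta_bichar v u) mulVf ?(bichar_neq0 beta_bichar).
have XV : invmx (X t) *m invmx (X s) = beta t s *: (invmx (X s) *m invmx (X t)).
  apply: (can_inj (mulKmx (Xu t))); apply: (can_inj (mulKmx (Xu s))).
  rewrite mulKVmx // mulmxV // -!scalemxAr !mulmxA (twb_comm Xtw).
  by rewrite -!scalemxAl mulmxK // mulmxV // scalerA beta1 scale1r.
rewrite /= !mulmxA (twb_comm Ytw) -!mulmxA XV -!scalemxAr -!scalemxAl scalerA.
by rewrite beta1 scale1r !mulmxA.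
Qed.

(** Two families with the same commutation relations are conjugate up to
    scalars.  The operators A |-> Y_t A X_t^-1 commute, since the scalars
    beta(s,t) and beta(t,s) cancel; a common eigenvector M satisfies
    Y_t M = a_t M X_t.  Its left kernel is stable under every Y_t, hence under
    all matrices, so it is 0 as M <> 0. *)
Lemma twb_intertwiner : exists2 M : 'M[F]_n, M \in unitmx &
  forall t, M *m X t *m invmx M \in <[Y t]>%VS.
Proof.
have nn0 : (0 < n * n)%N by rewrite -(twb_card Xtw) -cardsT cardG_gt0.
have [|v v0 vP] := @comm_eigenvector F _ [seq lin_mx (Z t) | t <- enum T] nn0.
  move=> _ _ /mapP[s _ ->] /mapP[t _ ->]; apply/row_matrixP => i.
  rewrite !rowE !mulmxA -[delta_mx 0 i]vec_mxK !mul_vec_lin.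
  by rewrite ZC.
pose M := vec_mx v; have M0 : M != 0 by rewrite vec_mx_eq0.
have MP t : exists a, Y t *m M = a *: (M *m X t).
  have [|a aP] := vP (lin_mx (Z t)).
    by apply/mapP; exists t; rewrite ?mem_enum.
  exists a; rewrite scalemxAl /M -linearZ /= -aP mx_rV_lin /= -mulmxA.
  by rewrite mulmxKV ?(twb_unit Xtw).
have Mu : M \in unitmx.
  rewrite -row_free_unit -kermx_eq0; apply: contraNT M0 => kM.
  pose w := nz_row (kermx M); have w0 : w != 0 by rewrite nz_row_eq0.
  have wM : w *m M = 0 by apply/sub_kermxP/nz_row_sub.
  have wAM A : w *m A *m M = 0.
    have [c ->] := twb_span beta_bichar beta_nondeg Ytw A.
    rewrite mulmx_sumr mulmx_suml big1 // => t _.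
    have [a aP] := MP t; rewrite -scalemxAr -scalemxAl -mulmxA aP -scalemxAr.
    by rewrite mulmxA wM mul0mx !scaler0.
  (* Applied to the elementary matrices, this says that each row of M is 0. *)
  have [i wi] : exists i, w 0 i != 0.
    apply/existsP; apply: contraNT w0; rewrite negb_exists => /forallP w0.
    by apply/eqP/rowP => i; rewrite mxE; apply/eqP; have := w0 i; rewrite negbK.
  apply/eqP/row_matrixP => j; rewrite row0 rowE.
  apply: (scalerI wi); rewrite scaler0 -(wAM (delta_mx i j)) scalemxAl.
  congr (_ *m _); apply/rowP => m; rewrite !mxE (bigD1 i) //= big1 => [|p pi].
    by rewrite !mxE eqxx addr0.
  by rewrite !mxE (negPf pi) mulr0.
exists M => // t; have [a aP] := MP t; have a0 : a != 0.
  apply/eqP => a0; move: aP; rewrite a0 scale0r.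
  have := unitmx_neq0 Xtw (A := Y t *m M).
  by rewrite unitmx_mul (twb_unit Ytw) Mu => /(_ isT) /eqP.
apply/vlineP; exists a^-1.
have -> : M *m X t = a^-1 *: (Y t *m M) by rewrite aP scalerA mulVf ?scale1r.
by rewrite -scalemxAl mulmxK.
Qed.

End Intertwiner.

(** * Kronecker products *)

Section Tensor.
Variables (F : fieldType).

Lemma tensmx_linear m n p q (A : 'M[F]_(m, n)) :
  linear (tensmx A : 'M[F]_(p, q) -> _).
Proof.
by move=> c B C; apply/matrixP => i j; rewrite !mxE mulrDr mulrCA.
Qed.

HB.instance Definition _ m n p q (A : 'M[F]_(m, n)) :=
  GRing.isLinear.Build F 'M[F]_(p, q) 'M[F]_(m * p, n * q) _ (tensmx A)
    (tensmx_linear A).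

Lemma tensmx_suml m n p q (I : finType) (A : I -> 'M[F]_(m, n))
    (B : 'M[F]_(p, q)) :
  (\sum_i A i) *t B = \sum_i (A i *t B).
Proof.
apply: (big_morph (fun A => A *t B)) => [C D|]; last exact: tens0mx.
by apply/matrixP => i j; rewrite !mxE mulrDl.
Qed.

Lemma tensmx11 m n : 1%:M *t 1%:M = 1%:M :> 'M[F]_(m * n).
Proof.
apply/matrixP => i j; case: (mxtens_indexP i) => i1 i2.
case: (mxtens_indexP j) => j1 j2; rewrite tensmxE !mxE -natrM mulnb.
by rewrite (can_eq (@mxtens_indexK m n)).
Qed.

Lemma tens_delta_inj m n p q (i : 'I_m) (j : 'I_n) :
  injective (tensmx (delta_mx i j) : 'M[F]_(p, q) -> _).
Proof.
move=> A B /matrixP AB; apply/matrixP => a b.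
have := AB (mxtens_index (i, a)) (mxtens_index (j, b)).
by rewrite !tensmxE !mxE !eqxx !mul1r.
Qed.

Lemma sum_delta_mx n : \sum_(i < n) delta_mx i i = 1%:M :> 'M[F]_n.
Proof.
apply/matrixP => a b; rewrite summxE !mxE (bigD1 a) //= big1 => [|i ia].
  by rewrite mxE eqxx addr0 eq_sym.
by rewrite mxE eq_sym (negPf ia).
Qed.

Lemma conj_algaut n (Q : 'M[F]_n) : Q \in unitmx ->
  exists f : algaut F n, forall A, val f A = Q *m A *m invmx Q.
Proof.
move=> Qu; pose h : 'End('M[F]_n) := linfun (mulmxr (invmx Q) \o mulmx Q).
have hE A : h A = Q *m A *m invmx Q by rewrite lfunE.
suff hA : is_algaut h by exists (exist _ h hA).
apply/asboolP; split=> [||A B]; rewrite ?hE ?mulmx1 ?mulmxV //.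
  exists (fun A => invmx Q *m A *m Q) => A; rewrite hE !mulmxA.
    by rewrite mulVmx // mul1mx mulmxKV.
  by rewrite mulmxV // mul1mx mulmxK.
by rewrite !mulmxA mulmxKV.
Qed.

End Tensor.

(** * The generalized Pauli matrices *)

Section BigTensor.
Variable F : fieldType.

Lemma bigtensM r (l : 'I_r -> nat) (A B : forall i, 'M[F]_(l i)) :
  bigtens A *m bigtens B = bigtens (fun i => A i *m B i).
Proof.
by elim: r l A B => [|r IHr] l A B /=; rewrite ?mul1mx // tensmx_mul IHr.
Qed.

Lemma bigtens1 r (l : 'I_r -> nat) :
  bigtens (fun i => 1%:M : 'M[F]_(l i)) = 1%:M.
Proof. by elim: r l => [|r IHr] l //=; rewrite IHr tensmx11. Qed.

Lemma bigtensZ r (l : 'I_r -> nat) (c : 'I_r -> F) (A : forall i, 'M[F]_(l i)) :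
  bigtens (fun i => c i *: A i) = (\prod_i c i) *: bigtens A.
Proof.
elim: r l c A => [|r IHr] l c A /=; first by rewrite big_ord0 scale1r.
rewrite big_ord_recl IHr; apply/matrixP => i j; rewrite !mxE.
by rewrite mulrACA.
Qed.

Lemma eq_bigtens r (l : 'I_r -> nat) (A B : forall i, 'M[F]_(l i)) :
  (forall i, A i = B i) -> bigtens A = bigtens B.
Proof.
elim: r l A B => [|r IHr] l A B AB //=.
by rewrite AB; congr (_ *t _); apply: IHr => i; rewrite AB.
Qed.

Definition commutes_up_to n (c : F) (A B : 'M[F]_n) := A *m B = c *: (B *m A).

Lemma commutes_up_to1 n (A : 'M[F]_n) : commutes_up_to 1 A 1%:M.
Proof. by rewrite /commutes_up_to mulmx1 mul1mx scale1r. Qed.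

Lemma commutes_up_toM n c d (A B C : 'M[F]_n) :
  commutes_up_to c A B -> commutes_up_to d A C ->
  commutes_up_to (c * d) A (B *m C).
Proof.
rewrite /commutes_up_to => AB AC.
by rewrite mulmxA AB -scalemxAl -!mulmxA AC -scalemxAr scalerA.
Qed.

Lemma commutes_up_to_sym n c (A B : 'M[F]_n) : c != 0 ->
  commutes_up_to c A B -> commutes_up_to c^-1 B A.
Proof. by rewrite /commutes_up_to => c0 ->; rewrite scalerA mulVf ?scale1r. Qed.

Lemma commutes_bigtens r (l : 'I_r -> nat) c (A B : forall i, 'M[F]_(l i)) :
  (forall i, commutes_up_to (c i) (A i) (B i)) ->
  commutes_up_to (\prod_i c i) (bigtens A) (bigtens B).
Proof.
by move=> AB; rewrite /commutes_up_to !bigtensM -bigtensZ; apply: eq_bigtens.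
Qed.

Lemma bigtens_unit r (l : 'I_r -> nat) (A : forall i, 'M[F]_(l i)) :
  (forall i, A i \in unitmx) -> bigtens A \in unitmx.
Proof.
move=> Au; suff : bigtens A *m bigtens (fun i => invmx (A i)) = 1%:M.
  by case/mulmx1_unit.
by rewrite bigtensM -bigtens1; apply: eq_bigtens => i; rewrite mulmxV.
Qed.

Definition tens_at r (l : 'I_r -> nat) (i : 'I_r) (A : forall j, 'M[F]_(l j)) :=
  bigtens (fun j => if j == i then A j else 1%:M).

Lemma tens_at_unit r (l : 'I_r -> nat) i (A : forall j, 'M[F]_(l j)) :
  A i \in unitmx -> tens_at i A \in unitmx.
Proof.
move=> Au; apply: bigtens_unit => j.
by case: eqP => [->|_] //; apply: unitmx1.
Qed.

Lemma tens_at_neq r (l : 'I_r -> nat) i j (A B : forall j, 'M[F]_(l j)) :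
  i != j -> commutes_up_to 1 (tens_at i A) (tens_at j B).
Proof.
move=> ij; have -> : 1 = \prod_(m < r) 1 :> F by rewrite big1.
apply: commutes_bigtens => m; have [->|_] := eqVneq m i.
  by rewrite (negPf ij); apply: commutes_up_to1.
by rewrite /commutes_up_to scale1r mulmx1 mul1mx.
Qed.

Lemma tens_at_eq r (l : 'I_r -> nat) i c (A B : forall j, 'M[F]_(l j)) :
  commutes_up_to c (A i) (B i) -> commutes_up_to c (tens_at i A) (tens_at i B).
Proof.
move=> AB; have -> : c = \prod_(m < r) (if m == i then c else 1).
  by rewrite -big_mkcond big_pred1_eq.
apply: commutes_bigtens => m; case: eqP => [->|_] //; exact: commutes_up_to1.
Qed.

Lemma clock_unit m (eps : F) : eps != 0 -> clock_mx m eps \in unitmx.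
Proof.
move=> e0; rewrite unitmxE det_diag unitfE; apply/prodf_neq0 => i _.
by rewrite mxE expf_neq0.
Qed.

Lemma shift_unit m : shift_mx F m \in unitmx.
Proof.
suff -> : shift_mx F m = perm_mx (perm (@ordS_inj m)) by apply: unitmx_perm.
apply/matrixP => i j; rewrite !mxE permE.
by rewrite -val_eqE /= eq_sym.
Qed.

Lemma clock_shift m (eps : F) : m.-primitive_root eps ->
  commutes_up_to eps (clock_mx m eps) (shift_mx F m).
Proof.
move=> prim; have m0 := prim_order_gt0 prim.
apply/matrixP => i j; rewrite mul_diag_mx mul_mx_diag !mxE.
case: eqP => [->|_]; last by rewrite mul0r !mulr0.
rewrite mulr1 mul1r.
have [im|] := ltnP i.+1 m.
  rewrite modn_small // -exprS; congr (_ ^+ _).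
  by rewrite -subSn ?subSS // -ltnS prednK.
move=> mi; have /eqP iE : i.+1 == m by rewrite eqn_leq ltn_ord.
have -> : (m.-1 - i = 0)%N.
  by apply/eqP; rewrite subn_eq0 -ltnS prednK // iE.
by rewrite expr0 iE modnn subn0 -exprS prednK // prim_expr_order.
Qed.

End BigTensor.

Section Pauli.
Variables (F : fieldType) (T : finGroupType) (beta : T -> T -> F).
Hypothesis beta_bichar : alternating_bicharacter beta.
Variables (r : nat) (l : 'I_r -> nat) (a b : 'I_r -> T).
Hypothesis ab_gen : symplectic_generators beta l a b.

Local Notation pa := (pauli_a beta l a b).
Local Notation pb := (pauli_b F l).
Local Notation M := 'M[F]_(tens_dim l).

(** Reduces invertibility and the commutation relations to the generators; K is
    a relation so that the degree of a product can be followed. *)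
Lemma pauli_prod_ind (K : M -> T -> Prop) :
  K 1%:M 1%g ->
  (forall A B u v, K A u -> K B v -> K (A *m B) (u * v)%g) ->
  (forall i, K (pa i) (a i)) -> (forall i, K (pb i) (b i)) ->
  forall e : pauli_exponents l, K (pauli_prod beta a b e) (pauli_elt a b e).
Proof.
move=> K1 KM Ka Kb e; rewrite /pauli_prod /pauli_elt.
have KX A u m : K A u -> K (A ^+ m) (u ^+ m)%g.
  by move=> KA; elim: m => [//|m IHm]; rewrite exprS expgS; apply: KM.
apply: (big_ind2 K) => // [A u B v|i _]; first exact: KM.
by apply: (KM); apply: KX.
Qed.

(** Both sides are multiplicative in each argument, which leaves the relations
    between generators.  Generators living in distinct tensor factors commute;
    in the same factor, the clock and shift matrices give epsilon_i. *)
Lemma pauli_commutes (e e' : pauli_exponents l) : commutes_up_to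
  (beta (pauli_elt a b e) (pauli_elt a b e'))
  (pauli_prod beta a b e) (pauli_prod beta a b e').
Proof.
have [b0 bMl bMr _] := beta_bichar; have [_ _ _ Pab Pba Paa Pbb Pneq] := ab_gen.
have gen_r (A : M) u : (forall i, commutes_up_to (beta u (a i)) A (pa i)) ->
    (forall i, commutes_up_to (beta u (b i)) A (pb i)) ->
    forall e' : pauli_exponents l,
      commutes_up_to (beta u (pauli_elt a b e')) A (pauli_prod beta a b e').
  move=> Aa Ab.
  apply: (@pauli_prod_ind (fun B v => commutes_up_to (beta u v) A B)) => //.
    by rewrite (bichar1r beta_bichar); apply: commutes_up_to1.
  by move=> B C v w AB AC; rewrite bMr; apply: commutes_up_toM.
have sym (A B : M) u v :
    commutes_up_to (beta u v) A B -> commutes_up_to (beta v u) B A.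
  by rewrite (bichar_sym beta_bichar u v); apply: commutes_up_to_sym.
apply: (sym); move: e; apply: (gen_r) => i; apply: (sym); move: e';
  apply: (gen_r) => j; rewrite -!/(tens_at _ _); have [<-|ij] := eqVneq i j.
- by rewrite Paa; apply: tens_at_eq; rewrite /commutes_up_to scale1r.
- by rewrite Paa; apply: tens_at_neq.
- by apply: tens_at_eq; apply: clock_shift.
- by rewrite (proj1 (Pneq _ _ ij)); apply: tens_at_neq.
- by apply: sym; apply: tens_at_eq; apply: clock_shift.
- by rewrite (proj2 (Pneq _ _ _)) 1?eq_sym //; apply: tens_at_neq.
- by rewrite Pbb; apply: tens_at_eq; rewrite /commutes_up_to scale1r.
- by rewrite Pbb; apply: tens_at_neq.
Qed.

Lemma pauli_prod_unit (e : pauli_exponents l) :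
  pauli_prod beta a b e \in unitmx.
Proof.
apply: (@pauli_prod_ind (fun A _ => A \in unitmx)) => [|A B _ _ Au Bu|i|i].
- exact: unitmx1.
- by rewrite unitmx_mul Au.
- by apply/tens_at_unit/clock_unit/(bichar_neq0 beta_bichar).
- by apply/tens_at_unit/shift_unit.
Qed.

(* The notation for direct products denotes the empty set when the product is
   not direct, so that each factor is a group has to be extracted from the
   global decomposition. *)
Let factor i : exists G : {group T}, (<[a i]> \x <[b i]>)%g = G.
Proof.
have := sympl_dprod ab_gen; rewrite (bigD1 i) //= => /dprodP[[G _ -> _] _ _ _].
by exists G.
Qed.

Lemma pauli_elt_surj t : exists e : pauli_exponents l, pauli_elt a b e == t.
Proof.
have [c [cP tE _]] := mem_bigdprod (sympl_dprod ab_gen) (in_setT t).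
have /fin_all_exists[e eP] i : exists m : 'I_(l i) * 'I_(l i),
    c i = (a i ^+ m.1 * b i ^+ m.2)%g.
  have [G GE] := factor i; have := cP i isT; rewrite GE => cG.
  have [y [z [ya zb -> _]]] := mem_dprod GE cG.
  have [p pl ->] := cyclePmin ya; have [q ql ->] := cyclePmin zb.
  rewrite (sympl_order_a ab_gen) in pl; rewrite (sympl_order_b ab_gen) in ql.
  by exists (Ordinal pl, Ordinal ql).
exists (finfun e); rewrite /pauli_elt tE; apply/eqP/eq_bigr => i _.
by rewrite ffunE eP.
Qed.

Lemma pauli_mxE t : exists2 e : pauli_exponents l, pauli_elt a b e = t &
  pauli_mx beta l a b t = pauli_prod beta a b e.
Proof.
rewrite /pauli_mx; case: pickP => [e /eqP et|no]; first by exists e.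
by have [e] := pauli_elt_surj t; rewrite no.
Qed.

(** The cardinality holds because T is the direct product of two cyclic groups
    of order l_i for each i, while the matrices have size the product of the
    l_i. *)
Lemma pauli_twisted_basis : twisted_basis beta (pauli_mx beta l a b).
Proof.
split=> [t|u v|].
- by have [e _ ->] := pauli_mxE t; apply: pauli_prod_unit.
- have [e <- ->] := pauli_mxE u; have [e' <- ->] := pauli_mxE v.
  exact: pauli_commutes.
rewrite tens_dimE -big_split /= -cardsT -(bigdprod_card (sympl_dprod ab_gen)).
apply: eq_bigr => i _; have [G GE] := factor i; rewrite GE -(dprod_card GE).
by rewrite -!/(order _) (sympl_order_a ab_gen) (sympl_order_b ab_gen).
Qed.

End Pauli.

(** * Homogeneous elements and automorphisms of the matrix grading *)

Section MatrixGradingBasis.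
Variables (F : fieldType) (T : finGroupType) (beta : T -> T -> F).
Hypothesis beta_bichar : alternating_bicharacter beta.
Hypothesis beta_nondeg : nondegenerate_bichar beta.
Variables (n : nat) (X : T -> 'M[F]_n).
Hypothesis Xtw : twisted_basis beta X.
Variable k : nat.

Definition mx_index : finType := ('I_k * 'I_k * T)%type.

Definition hom_unit (x : mx_index) : 'M[F]_(k * n) :=
  delta_mx x.1.1 x.1.2 *t X x.2.

Definition hom_deg (x : mx_index) : tilde_group T k :=
  (tilde_g T x.1.1 * tilde_T k x.2 * (tilde_g T x.1.2)^-1)%g.

Definition idem (i : 'I_k) : 'M[F]_(k * n) := delta_mx i i *t 1%:M.

Local Notation Gamma := (matrix_grading k (fun t => <[X t]>%VS)).

Lemma matrix_gradingE g :
  Gamma g = (\sum_(x : mx_index | hom_deg x == g) <[hom_unit x]>)%VS.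
Proof.
rewrite /matrix_grading pair_big_dep /=.
rewrite (pair_big_dep predT (fun p t => hom_deg (p, t) == g)
  (fun p t => linfun (fun d => delta_mx p.1 p.2 *t d) @: <[X t]>)%VS) /=.
by apply: eq_big => [[[i j] t]|[[i j] t] _] //=; rewrite limg_line lfunE.
Qed.

(** The exponent of the i-th minus that of the j-th generator determines (i, j)
    unless i = j, when it is 0: components off the diagonal are lines, while
    all diagonal indices with the same t share one component. *)
Lemma hom_degP (x y : mx_index) : hom_deg x = hom_deg y <->
  x.2 = y.2 /\ (x.1 = y.1 \/ (x.1.1 = x.1.2 /\ y.1.1 = y.1.2)).
Proof.
case: x y => [[i j] s] [[p q] t] /=.
have deg2 a b u m : ((hom_deg (a, b, u)).2 : {ffun 'I_k -> int}) m
    = (m == a)%:R - (m == b)%:R.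
  transitivity (([ffun j => (j == a)%:R] + 0
     - [ffun j => (j == b)%:R] : {ffun 'I_k -> int}) m); first by [].
  by rewrite addr0 !ffunE.
have deg1 a b u : (hom_deg (a, b, u)).1 = u.
  by rewrite /hom_deg /= mul1g invg1 mulg1.
split.
  move=> d; split; first by rewrite -(deg1 i j s) d deg1.
  have d2 m : (m == i)%:R - (m == j)%:R = (m == p)%:R - (m == q)%:R :> int.
    by rewrite -(deg2 i j s m) d deg2.
  have := d2 i; have := d2 j; have := d2 p; rewrite !eqxx.
  have [<-|ij] := eqVneq i j.
    rewrite !subrr; have [->|] := eqVneq p q; first by right.
    by [].
  have [<-|ip] := eqVneq i p.
    by have [<-|jq] := eqVneq j q; [left | case: (eqVneq j i)].
  by case: (eqVneq p j); case: (eqVneq j p); case: (eqVneq p q);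
     case: (eqVneq j q); case: (eqVneq i q).
move=> [<- ijpq]; apply: injective_projections; first by rewrite !deg1.
apply/ffunP => m; rewrite !deg2.
by case: ijpq => [[-> ->]|[-> ->]] //; rewrite !subrr.
Qed.

Lemma idemM i j : idem i *m idem j = if i == j then idem i else 0.
Proof.
rewrite /idem tensmx_mul mul_delta_mx_cond mulmx1.
by case: eqP => [->|_]; rewrite ?mulr1n ?mulr0n ?tens0mx.
Qed.

Lemma sum_idem : \sum_i idem i = 1%:M.
Proof. by rewrite /idem -tensmx_suml sum_delta_mx tensmx11. Qed.

Lemma corner_hom_unit p q x :
  idem p *m hom_unit x *m idem q = if x.1 == (p, q) then hom_unit x else 0.
Proof.
case: x => [[i j] t]; rewrite /idem /hom_unit /= !tensmx_mul mul1mx mulmx1.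
rewrite mul_delta_mx_cond xpair_eqE eq_sym.
case: (eqVneq i p) => [->|_]; last by rewrite mulr0n mul0mx tens0mx.
rewrite mulr1n mul_delta_mx_cond; case: (eqVneq j q) => [->|_] //.
by rewrite mulr0n tens0mx.
Qed.

Lemma hom_line x A : A \in <[X x.2]>%VS ->
  delta_mx x.1.1 x.1.2 *t A \in <[hom_unit x]>%VS.
Proof. by case/vlineP=> c ->; apply/vlineP; exists c; rewrite linearZ. Qed.

Lemma hom_unit_neq0 x : hom_unit x != 0.
Proof.
rewrite /hom_unit -(linear0 (tensmx (delta_mx x.1.1 x.1.2))).
rewrite (inj_eq (@tens_delta_inj _ _ _ _ _ _ _)).
by rewrite (unitmx_neq0 Xtw) ?(twb_unit Xtw).
Qed.

Lemma hom_unit_inj A x y : A != 0 ->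
  A \in <[hom_unit x]>%VS -> A \in <[hom_unit y]>%VS -> x = y.
Proof.
move=> A0 /vlineP[a Aa] /vlineP[b Ab].
have a0 : a != 0 by apply: contraNneq A0 => a0; rewrite Aa a0 scale0r.
have /eqP xy : x.1 == y.1.
  rewrite eq_sym; apply: contraNT A0 => /negPf yx.
  rewrite Aa scaler_eq0 (negPf a0) /=.
  have := corner_hom_unit x.1.1 x.1.2 x; rewrite -surjective_pairing eqxx => xE.
  apply/eqP/(scalerI a0); rewrite scaler0 -xE.
  rewrite scalemxAl scalemxAr -Aa Ab -scalemxAr -scalemxAl corner_hom_unit.
  by rewrite -surjective_pairing yx scaler0.
case: x y xy Aa Ab {A0} => [p s] [p' t] /= <- Aa Ab; congr (_, _).
apply: (twb_line_inj beta_bichar beta_nondeg Xtw).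
apply/vlineP; exists (a^-1 * b).
apply: (@tens_delta_inj F _ _ _ _ p.1 p.2); rewrite linearZ /= -scalerA.
rewrite -[_ *t X t]/(hom_unit (p, t)).
by rewrite -Ab Aa scalerA mulVf ?scale1r.
Qed.

Lemma hom_unitM i j m s t : exists2 c, c != 0 &
  hom_unit (i, j, s) *m hom_unit (j, m, t) = c *: hom_unit (i, m, (s * t)%g).
Proof.
have /vlineP[c cE] := twb_homogM beta_bichar beta_nondeg Xtw
  (memv_line (X s)) (memv_line (X t)).
exists c; last by rewrite /hom_unit tensmx_mul mul_delta_mx cE linearZ.
apply: contraNneq (unitmx_neq0 Xtw (A := X s *m X t) _) => [c0|].
  by rewrite cE c0 scale0r.
by rewrite unitmx_mul !(twb_unit Xtw).
Qed.

Lemma idem_line i A :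
  (A \in <[hom_unit (i, i, 1%g)]>%VS) = (A \in <[idem i]>%VS).
Proof.
have /vlineP[c cE] := twb_homog1 beta_bichar beta_nondeg Xtw.
have iE : idem i = c *: hom_unit (i, i, 1%g) by rewrite /idem cE linearZ.
have c0 : c != 0.
  apply: contraNneq (unitmx_neq0 Xtw (unitmx1 _ _)) => c0.
  by rewrite cE c0 scale0r.
apply/vlineP/vlineP => -[a ->]; last by exists (a * c); rewrite iE scalerA.
by exists (a / c); rewrite iE scalerA mulfVK.
Qed.

(** A corner e_p A e_q of a homogeneous A only sees the basis elements
    E_pq (x) X_t, and the degree of A determines t. *)
Lemma corner_component g A p q : A \in Gamma g ->
  idem p *m A *m idem q != 0 -> exists2 t, hom_deg (p, q, t) = g &
    idem p *m A *m idem q \in <[hom_unit (p, q, t)]>%VS.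
Proof.
rewrite matrix_gradingE => /memv_sumP[v vP ->].
rewrite mulmx_sumr mulmx_suml.
have vE x : hom_deg x == g -> idem p *m v x *m idem q =
    if x.1 == (p, q) then v x else 0.
  case/vP/vlineP => c ->; rewrite -scalemxAr -scalemxAl corner_hom_unit.
  by case: ifP; rewrite ?scaler0.
case: (pickP (fun t => hom_deg (p, q, t) == g)) => [t /eqP tg _|no].
  exists t => //; apply: memv_suml => x xg; rewrite vE //.
  case: eqP => [xpq|_]; last exact: mem0v.
  suff <- : x = (p, q, t) by apply: vP.
  have /hom_degP[x2 _] : hom_deg x = hom_deg (p, q, t) by rewrite (eqP xg).
  by case: x xpq x2 {xg} => ? ? /= -> ->.
case/eqP; apply: big1 => x xg; rewrite vE //; case: eqP => // xpq.
by have := no x.2; rewrite -xpq -surjective_pairing xg.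
Qed.

Hypothesis abT : abelian [set: T].

Let TC (s t : T) : (s * t = t * s)%g.
Proof. by apply: (centsP abT); rewrite inE. Qed.

Local Notation Tpow := {dffun forall _ : 'I_k, T}.
Local Notation actors := (weyl_actors beta k).
Local Notation dcoset := (coset (Defs.diagonal T k)).

(** The permutation of the homogeneous lines attached to a label.  The function
    c is indexed by the target pi i so that composition of labels is literally
    the product of the semidirect product, whose action precomposes with the
    inverse of pi. *)
Definition relabel (a : {perm T} * 'S_k) (c : Tpow) (x : mx_index) : mx_index :=
  (a.2 x.1.1, a.2 x.1.2,
   c (a.2 x.1.1) * a.1 x.2 * (c (a.2 x.1.2))^-1)%g.

Definition acts_as (f : algaut F (k * n)) a c : Prop :=
  forall x, val f (hom_unit x) \in <[hom_unit (relabel a c x)]>%VS.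

Lemma coset_diagP (c d : Tpow) :
  dcoset c = dcoset d <->
  exists z, forall i, c i = (z * d i)%g.
Proof.
have nD := diagonal_norm abT.
split=> [/(kercoset_rcoset (nD _ c) (nD _ d))|[z zE]].
  case=> _ /imsetP[z _ ->] /ffunP zE.
  by exists z => i; rewrite zE !ffunE.
apply/(rcoset_kercosetP (nD _ c) (nD _ d)); apply/rcosetP.
by exists [ffun=> z]; [apply: imset_f | apply/ffunP => i; rewrite !ffunE zE].
Qed.

Lemma relabel_coset a c d : dcoset c = dcoset d ->
  relabel a c =1 relabel a d.
Proof.
move=> /coset_diagP[z zE] x; rewrite /relabel !zE invMg; congr (_, _).
by rewrite -!mulgA TC !mulgA mulgKV.
Qed.

Lemma relabelM a b c d x : a \in actors ->
  relabel a c (relabel b d x) = relabel (b * a)%g (pow_act d a * c)%g x.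
Proof.
move=> aA; rewrite /relabel /= !permM; congr (_, _).
have a1 : a.1 1%g = 1%g by apply/(mulgI (a.1 1%g)); rewrite -(autM aA) !mulg1.
have aV u : a.1 u^-1%g = (a.1 u)^-1%g.
  by apply/(mulgI (a.1 u)); rewrite -(autM aA) !mulgV.
rewrite !ffunE !permK !(autM aA) aV invMg !mulgA (TC (c _)) -!mulgA.
by rewrite (TC (a.1 (d (b.2 x.1.2)))^-1).
Qed.

Lemma relabel_inj a c : injective (relabel a c).
Proof.
move=> [[i j] s] [[p q] t] []; rewrite /= => /perm_inj-> /perm_inj->.
by move/mulIg/mulgI/perm_inj=> ->.
Qed.

(** Off the diagonal, equal degrees mean equal indices; on the diagonal the
    factors c and c^-1 cancel in the abelian group T.  So a relabelling sends
    indices sharing a component to indices sharing a component. *)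
Lemma relabel_hom_deg a c x y :
  hom_deg (relabel a c x) = hom_deg (relabel a c y) <-> hom_deg x = hom_deg y.
Proof.
have diag i t : (c i * t * (c i)^-1)%g = t by rewrite (TC (c i)) mulgK.
case: x y => [[i j] s] [[p q] t].
split=> /hom_degP /= [st ijpq]; apply/hom_degP.
  case: ijpq => [[/perm_inj ip /perm_inj jq]|[/perm_inj ij /perm_inj pq]]; subst.
    by split; last left; move/mulIg/mulgI/perm_inj: st.
  by move: st; rewrite !diag => /perm_inj->; split; last right.
rewrite /= {}st; case: ijpq => [[-> ->]|[-> ->]]; first by split; last left.
by rewrite !diag; split; last right.
Qed.

Lemma relabel_surj a c y : exists x, relabel a c x = y.
Proof. by have [h _ hK] := injF_bij (@relabel_inj a c); exists (h y). Qed.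

Lemma algaut_eq0 (f : algaut F (k * n)) A : (val f A == 0) = (A == 0).
Proof.
have [bf _ _] := algautP f; rewrite -{1}(linear0 (val f)).
exact: (inj_eq (bij_inj bf)).
Qed.

Lemma acts_as_mul f g a b c d : a \in actors ->
  acts_as f a c -> acts_as g b d ->
  acts_as (f * g)%g (b * a)%g (pow_act d a * c)%g.
Proof.
move=> aA fP gP x; rewrite algautME comp_lfunE -(relabelM b c d x aA).
have /vlineP[u ->] := gP x; rewrite linearZ; apply: memvZ; exact: fP.
Qed.

Lemma acts_as_coset f a c d : dcoset c = dcoset d ->
  acts_as f a c -> acts_as f a d.
Proof. by move=> cd fP x; rewrite -(relabel_coset a cd). Qed.

Lemma acts_as_line f a c x : acts_as f a c ->
  (val f @: <[hom_unit x]>)%VS = <[hom_unit (relabel a c x)]>%VS.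
Proof.
move=> fP; rewrite limg_line; have /vlineP[u uE] := fP x.
have u0 : u != 0.
  apply: contraNneq (hom_unit_neq0 x) => u0.
  by rewrite -(algaut_eq0 f) uE u0 scale0r.
apply/vspaceP => A; apply/vlineP/vlineP => -[v ->].
  by exists (v * u); rewrite uE scalerA.
by exists (v / u); rewrite uE scalerA mulfVK.
Qed.

Lemma acts_as_component f a c x : acts_as f a c ->
  (val f @: Gamma (hom_deg x))%VS = Gamma (hom_deg (relabel a c x)).
Proof.
move=> fP; rewrite !matrix_gradingE limg_sum.
rewrite [RHS](reindex_inj (@relabel_inj a c)) /=.
apply: eq_big => [y|y _]; last exact: acts_as_line.
by apply/eqP/eqP => /relabel_hom_deg.
Qed.

Lemma hom_unit_component x : hom_unit x \in Gamma (hom_deg x).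
Proof.
by rewrite matrix_gradingE memvE (sumv_sup x).
Qed.

Lemma supportP g : grading_support Gamma g <-> exists x, g = hom_deg x.
Proof.
split=> [|[x ->]]; last first.
  apply: contraNneq (hom_unit_neq0 x) => g0.
  by rewrite -memv0 -g0 hom_unit_component.
rewrite /grading_support /= matrix_gradingE => g0.
case: (pickP (fun x => hom_deg x == g)) => [x /eqP <-|no]; first by exists x.
by case/eqP: g0; apply: big1 => x; rewrite no.
Qed.

Lemma acts_as_permutes f a c : acts_as f a c -> permutes_components Gamma f.
Proof.
move=> fP; apply/asboolP/seteqP; split=> [_ [_ [g /supportP[x ->] <-] <-]|].
  rewrite (acts_as_component x fP); eexists; last reflexivity.
  by apply/supportP; exists (relabel a c x).
move=> _ [g /supportP[y ->] <-]; have [x <-] := relabel_surj a c y.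
exists (Gamma (hom_deg x)); last exact: acts_as_component.
by exists (hom_deg x) => //; apply/supportP; exists x.
Qed.

Hypothesis k_gt0 : (0 < k)%N.
Let o : 'I_k := Ordinal k_gt0.

(** A nonzero matrix lies on at most one of the homogeneous lines, so f
    determines the relabelling.  Indices
    (i, i, t) recover alpha, and (i, j, 1) recovers the quotients of the values
    of c, that is, c up to the diagonal. *)
Lemma acts_as_uniq f a b c d : acts_as f a c -> acts_as f b d ->
  a = b /\ dcoset c = dcoset d.
Proof.
move=> fa fb.
have E x : relabel a c x = relabel b d x.
  by apply: hom_unit_inj (fa x) (fb x); rewrite algaut_eq0 hom_unit_neq0.
have ab : a = b.
  apply: injective_projections; apply/permP => y.
    by have [_ _ +] := E (o, o, y); rewrite (TC (c _)) (TC (d _)) !mulgK.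
  by have [] := E (y, y, 1%g).
split=> //; apply/coset_diagP; exists ((d o)^-1 * c o)%g => m.
have [_ _] := E (a.2^-1 m, a.2^-1 o, a.1^-1 1)%g; rewrite -ab !permKV !mulg1.
by move=> cd; rewrite (TC _ (d m)) mulgA -cd mulgKV.
Qed.

(** The witness is the monomial block matrix with block X_c(pi i) M in row pi i
    and column i: M realizes alpha, the X_c translate by c, and the positions of
    the blocks permute the indices. *)
Lemma acts_as_conj (M : 'M[F]_n) (a : {perm T} * 'S_k) (c : Tpow) :
  M \in unitmx ->
  (forall t, M *m X t *m invmx M \in <[X (a.1 t)]>%VS) ->
  exists f, acts_as f a c.
Proof.
move=> Mu MP; have Xu := twb_unit Xtw.
pose N i := X (c (a.2 i)) *m M.
have Nu i : N i \in unitmx by rewrite unitmx_mul Xu.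
pose Q := \sum_i (delta_mx (a.2 i) i *t N i).
pose Q' := \sum_i (delta_mx i (a.2 i) *t invmx (N i)).
have Ql i m (A : 'M[F]_n) :
    Q *m (delta_mx i m *t A) = delta_mx (a.2 i) m *t (N i *m A) :> 'M_(k * n).
  rewrite mulmx_suml (bigD1 i) //= big1 ?addr0 => [|j ji].
    by rewrite tensmx_mul mul_delta_mx.
  by rewrite tensmx_mul mul_delta_mx_0 ?tens0mx.
have Qr j m (A : 'M[F]_n) :
    (delta_mx m j *t A) *m Q'
      = delta_mx m (a.2 j) *t (A *m invmx (N j)) :> 'M_(k * n).
  rewrite mulmx_sumr (bigD1 j) //= big1 ?addr0 => [|i ji].
    by rewrite tensmx_mul mul_delta_mx.
  by rewrite tensmx_mul mul_delta_mx_0 ?tens0mx // eq_sym.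
have QQ' : Q *m Q' = 1%:M.
  rewrite mulmx_sumr -[RHS]sum_idem [RHS](reindex_inj (@perm_inj _ a.2)).
  by apply: eq_bigr => i _; rewrite Ql mulmxV.
have [Qu _] := mulmx1_unit QQ'.
have QV : invmx Q = Q' by rewrite -[LHS]mulmx1 -QQ' mulmxA mulVmx // mul1mx.
have [f fE] := conj_algaut Qu; exists f => -[[i j] t].
rewrite fE QV /hom_unit /= Ql Qr.
apply: (@hom_line (relabel a c (i, j, t))) => /=.
have homM := twb_homogM beta_bichar beta_nondeg Xtw.
have homV := twb_homogV beta_bichar beta_nondeg Xtw.
have -> : N i *m X t *m invmx (N j) =
    X (c (a.2 i)) *m (M *m X t *m invmx M) *m invmx (X (c (a.2 j))).
  apply: (can_inj (mulmxK (Nu j))); rewrite mulmxKV // /N !mulmxA.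
  by rewrite mulmxKV // mulmxKV.
apply: (homM); last by apply: homV; [exact: Xu | exact: memv_line].
by apply: homM (MP t); exact: memv_line.
Qed.

Lemma idem_neq0 i : idem i != 0.
Proof.
rewrite /idem -(linear0 (tensmx (delta_mx i i))).
by rewrite (inj_eq (@tens_delta_inj _ _ _ _ _ _ _)) (unitmx_neq0 Xtw) ?unitmx1.
Qed.

Lemma component_image f g : permutes_components Gamma f ->
  grading_support Gamma g ->
  exists2 h, grading_support Gamma h & (val f @: Gamma g)%VS = Gamma h.
Proof.
move=> /asboolP fP gS.
have [h hS hE] : components Gamma (val f @: Gamma g)%VS.
  by rewrite -fP; exists (Gamma g) => //; exists g.
by exists h.
Qed.

(** The corner of the identity at o is e_o, a multiple of E_oo (x) X_1, and a
    nonzero corner determines the degree. *)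
Lemma one_component h : 1%:M \in Gamma h -> h = hom_deg (o, o, 1%g).
Proof.
move=> /(@corner_component _ _ o o); rewrite mulmx1 idemM eqxx.
case=> [|t <- ot]; first exact: idem_neq0.
suff -> : t = 1%g by [].
have := hom_unit_inj (idem_neq0 o) ot; move/(_ (o, o, 1%g)).
by rewrite idem_line memv_line => /(_ isT)[].
Qed.

(** The off-diagonal corners of A vanish by degree, and a diagonal one is a
    multiple of e_p because X_1 is a scalar matrix. *)
Lemma unit_component A : A \in Gamma (hom_deg (o, o, 1%g)) ->
  exists v : 'I_k -> F, A = \sum_p v p *: idem p.
Proof.
move=> A1; have corner p q : idem p *m A *m idem q != 0 -> p = q /\
    idem p *m A *m idem q \in <[idem p]>%VS.
  move=> /(corner_component A1)[t /hom_degP /= [t1 pq]].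
  have <- : p = q by case: pq => [[-> ->]|[]].
  by rewrite t1 idem_line.
have /fin_all_exists[v vE] p : exists v, idem p *m A *m idem p = v *: idem p.
  have [->|/corner[_ /vlineP //]] := eqVneq (idem p *m A *m idem p) 0.
  by exists 0; rewrite scale0r.
exists v; rewrite -[LHS]mul1mx -[LHS]mulmx1 -sum_idem !mulmx_suml.
apply: eq_bigr => p _; rewrite mulmx_sumr (bigD1 p) //= big1 ?addr0 // => q qp.
apply/eqP; apply: contraNT qp => /corner[-> _]; exact: eqxx.
Qed.

(** f maps the component of degree 1, isomorphic to F^k, onto itself.  The
    coordinates v i p of f(e_i) satisfy v i p v j p = delta_ij v i p, so they
    are 0 or 1 and for each p at most one i has v i p <> 0; as each f(e_i) is
    nonzero, counting makes v a permutation matrix. *)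
Lemma permutes_idem f : permutes_components Gamma f ->
  exists pi : 'S_k, forall i, val f (idem i) = idem (pi i).
Proof.
move=> fP; have [bf f1 fM] := algautP f.
have unitS : grading_support Gamma (hom_deg (o, o, 1%g)).
  by apply/supportP; eexists.
have idem1 i : idem i \in Gamma (hom_deg (o, o, 1%g)).
  have -> : hom_deg (o, o, 1%g) = hom_deg (i, i, 1%g).
    by apply/hom_degP; split; last right.
  rewrite matrix_gradingE memvE; apply: (sumv_sup (i, i, 1%g)) => //.
  by rewrite -memvE idem_line memv_line.
have unit1 : (val f @: Gamma (hom_deg (o, o, 1%g)))%VS
    = Gamma (hom_deg (o, o, 1%g)).
  have [h _ hE] := component_image fP unitS; rewrite hE; congr matrix_grading.
  apply: one_component; rewrite -hE -f1 memv_img // -sum_idem.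
  by apply: rpred_sum => i _.
have /fin_all_exists[v vE] i : exists v : 'I_k -> F,
    val f (idem i) = \sum_p v p *: idem p.
  by apply: unit_component; rewrite -unit1 memv_img.
have vM i j p : v i p * v j p = if i == j then v i p else 0.
  have sumM w w' : (\sum_p w p *: idem p) *m (\sum_p w' p *: idem p)
      = \sum_p (w p * w' p) *: idem p :> 'M_(k * n).
    rewrite mulmx_suml; apply: eq_bigr => q _.
    rewrite mulmx_sumr (bigD1 q) //= big1 ?addr0 => [|m mq].
      by rewrite -scalemxAl -scalemxAr idemM eqxx scalerA.
    by rewrite -scalemxAl -scalemxAr idemM eq_sym (negPf mq) !scaler0.
  have sumI w w' : \sum_p w p *: idem p = \sum_p w' p *: idem p :> 'M_(k * n) ->
      w p = w' p.
    have wp u : idem p *m \sum_p u p *: idem p = u p *: idem p :> 'M_(k * n).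
      rewrite mulmx_sumr (bigD1 p) //= big1 ?addr0 => [|m mq].
        by rewrite -scalemxAr idemM eqxx.
      by rewrite -scalemxAr idemM eq_sym (negPf mq) !scaler0.
    move=> ww'; have := wp w; rewrite ww' wp => /eqP.
    rewrite -subr_eq0 -scalerBl scaler_eq0 (negPf (idem_neq0 p)) orbF subr_eq0.
    by move/eqP.
  apply: (sumI (fun p => v i p * v j p) (fun p => if i == j then v i p else 0)).
  rewrite -sumM -!vE -fM idemM; case: eqP => _; first by rewrite vE.
  by rewrite linear0 big1 // => q _; rewrite scale0r.
have /fin_all_exists[pi piP] i : exists p, v i p != 0.
  apply/existsP; have := idem_neq0 i; rewrite -(algaut_eq0 f) vE.
  apply: contraNT; rewrite negb_exists => /forallP v0.
  apply/eqP/big1 => p _; have := v0 p; rewrite negbK => /eqP->.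
  by rewrite scale0r.
(* Two idempotents f(e_i) and f(e_j) with i <> j are orthogonal, so they cannot
   both have a nonzero coordinate at p. *)
have pi_inj : injective pi.
  move=> i j ij; apply/eqP; have := vM i j (pi i); case: eqP => // _ /eqP.
  by rewrite mulf_eq0 (negPf (piP i)) ij (negPf (piP j)).
exists (perm pi_inj) => i; rewrite permE vE (bigD1 (pi i)) //= big1 => [|p pi'].
  have := vM i i (pi i); rewrite eqxx -{3}[v i (pi i)]mulr1.
  move=> /(mulfI (piP i)) ->.
  by rewrite scale1r addr0.
have [h _ hK] := injF_bij pi_inj; have := piP (h p); rewrite hK => vp.
have := vM i (h p) p; case: eqP => [ih|_ /eqP].
  by rewrite ih hK eqxx in pi'.
by rewrite mulf_eq0 (negPf vp) orbF => /eqP->; rewrite scale0r.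
Qed.

Lemma permutes_hom_unit f (pi : 'S_k) : permutes_components Gamma f ->
  (forall i, val f (idem i) = idem (pi i)) ->
  forall x, exists t,
    val f (hom_unit x) \in <[hom_unit (pi x.1.1, pi x.1.2, t)]>%VS.
Proof.
move=> fP piP x; have [_ _ fM] := algautP f.
have xE : idem (pi x.1.1) *m val f (hom_unit x) *m idem (pi x.1.2)
    = val f (hom_unit x).
  by rewrite -!piP -!fM corner_hom_unit -surjective_pairing eqxx.
have xS : grading_support Gamma (hom_deg x) by apply/supportP; exists x.
have [h _ hE] := component_image fP xS.
have : val f (hom_unit x) \in Gamma h.
  by rewrite -hE memv_img ?hom_unit_component.
move=> /(@corner_component _ _ (pi x.1.1) (pi x.1.2)); rewrite xE.
by case=> [|t _ xt]; [rewrite algaut_eq0 hom_unit_neq0 | exists t].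
Qed.

(** The map tau on indices inherits from f the cocycle relation
    tau(i,j,s) tau(j,m,t) = tau(i,m,st).  Factoring (i,j,t) through a base index
    o gives tau(i,j,t) = tau(i,o,1) tau(o,o,t) tau(j,o,1)^-1, which is
    the required form with alpha = tau(o,o,-) and c(pi i) = tau(i,o,1). *)
Lemma permutes_acts_as f : permutes_components Gamma f ->
  exists2 a, a \in actors & exists c, acts_as f a c.
Proof.
move=> fP; have [_ _ fM] := algautP f; have [pi piP] := permutes_idem fP.
have /fin_all_exists[tau tauP] := permutes_hom_unit fP piP.
have tauM i j m s t : (tau (i, j, s) * tau (j, m, t))%g = tau (i, m, (s * t)%g).
  have [u u0 uE] := hom_unitM i j m s t.
  have [w w0 wE] :=
    hom_unitM (pi i) (pi j) (pi m) (tau (i, j, s)) (tau (j, m, t)).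
  have fst0 : val f (hom_unit (i, m, (s * t)%g)) != 0.
    by rewrite algaut_eq0 hom_unit_neq0.
  suff fst1 : val f (hom_unit (i, m, (s * t)%g)) \in
      <[hom_unit (pi i, pi m, (tau (i, j, s) * tau (j, m, t))%g)]>%VS.
    by have [] := hom_unit_inj fst0 fst1 (tauP (i, m, (s * t)%g)).
  have -> : val f (hom_unit (i, m, (s * t)%g)) =
      u^-1 *: val f (hom_unit (i, j, s) *m hom_unit (j, m, t)).
    by rewrite uE linearZ scalerA mulVf ?scale1r.
  rewrite fM memvZ //.
  have /vlineP[y ->] := tauP (i, j, s); have /vlineP[z ->] := tauP (j, m, t).
  by rewrite -scalemxAl -scalemxAr wE !memvZ ?memv_line.
(* The o-th corner suffices to define alpha: the others carry the same
   automorphism up to conjugation by a value of tau, and T is abelian. *)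
pose alpha t := tau (o, o, t).
have alphaM : {morph alpha : s t / (s * t)%g}.
  by move=> s t; rewrite /alpha tauM.
have alphaB s t : beta (alpha s) (alpha t) = beta s t.
  have huC u v p : hom_unit (p, p, u) *m hom_unit (p, p, v)
      = beta u v *: (hom_unit (p, p, v) *m hom_unit (p, p, u)).
    by rewrite /hom_unit !tensmx_mul (twb_comm Xtw) linearZ.
  have : val f (hom_unit (o, o, t) *m hom_unit (o, o, s)) != 0.
    have [u u0 ->] := hom_unitM o o o t s.
    by rewrite algaut_eq0 scaler_eq0 negb_or u0 hom_unit_neq0.
  have := congr1 (val f) (huC s t o); rewrite linearZ /= !fM.
  have /vlineP[y ->] := tauP (o, o, s); have /vlineP[z ->] := tauP (o, o, t).
  rewrite -!scalemxAl -!scalemxAr huC !scalerA => /eqP.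
  set U := hom_unit _ *m hom_unit _.
  rewrite -subr_eq0 -scalerBl scaler_eq0 => /orP[|/eqP->]; last first.
    by rewrite scaler0 eqxx.
  rewrite subr_eq0 scaler_eq0 negb_or -/(alpha s) -/(alpha t).
  by rewrite -[_ * z * y]mulrA [y * z]mulrC [beta s t * _]mulrC =>
     /eqP st /andP[zy _]; apply: (mulfI zy).
have alpha_inj : injective alpha.
  move=> s t st; apply: (bichar_separates beta_bichar beta_nondeg) => u.
  by rewrite -alphaB st alphaB.
pose al := perm alpha_inj; exists (al, pi).
  apply/setXP; split; last by rewrite inE.
  apply/bichar_autP; split=> [|s t]; last by rewrite !permE.
  rewrite inE; apply/andP; split; first exact/subsetP.
  by apply/morphicP => s t _ _; rewrite !permE alphaM.
exists [ffun m => tau ((pi^-1)%g m, o, 1%g)] => -[[i j] t].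
rewrite /relabel /= !ffunE !permK permE; have := tauP (i, j, t) => /=.
have tau1 : tau (j, j, 1%g) = 1%g.
  by apply: (mulgI (tau (j, j, 1%g))); rewrite tauM !mulg1.
have -> : (tau (j, o, 1%g))^-1%g = tau (o, j, 1%g).
  by apply: (mulgI (tau (j, o, 1%g))); rewrite mulgV tauM mulg1 tau1.
by rewrite !tauM mul1g mulg1.
Qed.

Lemma component_inj x y : Gamma (hom_deg x) = Gamma (hom_deg y) ->
  hom_deg x = hom_deg y.
Proof.
move=> xy; have := hom_unit_component x; rewrite xy.
have xE : idem x.1.1 *m hom_unit x *m idem x.1.2 = hom_unit x.
  by rewrite corner_hom_unit -surjective_pairing eqxx.
move=> /(@corner_component _ _ x.1.1 x.1.2); rewrite xE.
case=> [|t <- xt]; first exact: hom_unit_neq0.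
by rewrite -(hom_unit_inj (hom_unit_neq0 x) (memv_line _) xt).
Qed.

(** An automorphism fixing all components must fix each degree.  Degrees of
    diagonal indices force alpha = 1; a point y moved by pi would make
    the off-diagonal index (y, pi y, 1) move; degrees of (i, o, 1) force
    c(i) = c(o). *)
Lemma acts_as_stab f a c : acts_as f a c ->
  (forall g, grading_support Gamma g -> (val f @: Gamma g)%VS = Gamma g) <->
  a = 1%g /\ dcoset c = dcoset 1%g.
Proof.
move=> fP; split=> [fS|[a1 /coset_diagP[z zE]] g /supportP[x ->]]; last first.
  rewrite (acts_as_component x fP) a1; congr (matrix_grading _ _ (hom_deg _)).
  case: x => [[i j] t]; rewrite /relabel /= !perm1 !zE !ffunE !mulg1.
  by rewrite (TC z) mulgK.
have fx x : hom_deg x = hom_deg (relabel a c x).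
  apply: component_inj; rewrite -(acts_as_component x fP) fS //.
  by apply/supportP; exists x.
have a1 : a = 1%g.
  apply: injective_projections; apply/permP => y; rewrite perm1.
    by have /hom_degP[/= + _] := fx (o, o, y); rewrite (TC (c _)) mulgK.
  by have /hom_degP[_ /=] := fx (y, a.2 y, 1%g); case=> [[]|[]].
split=> //; apply/coset_diagP; exists (c o) => i; rewrite ffunE mulg1.
have [-> //|io] := eqVneq i o.
have /hom_degP[/= + _] := fx (i, o, 1%g); rewrite a1 !perm1 mulg1 => ci.
by apply/(mulIg (c o)^-1%g); rewrite -ci mulgV.
Qed.

End MatrixGradingBasis.

(** * The Weyl group *)

Section WeylGroup.
Variables (F : closedFieldType) (T : finGroupType) (beta : T -> T -> F).
Hypothesis beta_bichar : alternating_bicharacter beta.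
Hypothesis beta_nondeg : nondegenerate_bichar beta.
Hypothesis abT : abelian [set: T].
Variables (n : nat) (X : T -> 'M[F]_n).
Hypothesis Xtw : twisted_basis beta X.
Variable k : nat.
Hypothesis k_gt0 : (0 < k)%N.

Local Notation Gamma := (matrix_grading k (fun t => <[X t]>%VS)).
Local Notation W := (sdprod_by (weyl_groupAction abT beta k)).
Local Notation Tpow m := {dffun forall _ : 'I_m, T}.
Local Notation Aut := (grading_aut Gamma).
Local Notation stab := (grading_stab Gamma).

(** The component of the label in T^(k-1) stands for its class in T^k / T,
    represented by the extension by 1. *)
Definition has_label (f : algaut F (k * n)) (s : W) :=
  acts_as X f s.1 (pow_ext s.2).

Let label_actor (s : W) : s.1 \in weyl_actors beta k.
Proof. by case: s => -[a t] /= /setXP[]. Qed.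

Lemma has_label_ex (f : Aut) : exists s, has_label (val f) s.
Proof.
have [a aA [c fP]] :=
  permutes_acts_as beta_bichar beta_nondeg Xtw k_gt0 (valP f).
have [t tE] := pow_quo_surj abT (coset (Defs.diagonal T k) c).
have atP : (a, t) \in setX (weyl_actors beta k) [set: Tpow k.-1].
  by apply/setXP; split=> //; rewrite inE.
exists (SdPair _ atP); exact: acts_as_coset (esym tE) fP.
Qed.

Lemma has_label_uniq f s t : has_label f s -> has_label f t -> s = t.
Proof.
move=> fs ft; have [st1 /(pow_quo_inj abT) st2] :=
  acts_as_uniq beta_bichar beta_nondeg Xtw abT k_gt0 fs ft.
by apply/val_inj/injective_projections.
Qed.

Lemma has_labelM f g s t : has_label f s -> has_label g t ->
  has_label (f * g)%g (t * s)%g.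
Proof.
have sA := label_actor s.
move=> fs gt; apply: acts_as_coset (acts_as_mul abT sA fs gt) => //.
rewrite -/(pow_quo _) /= pow_quoM // pow_quo_invK //.
have nD := diagonal_norm abT.
have sQ : s.1 \in qact_dom (pow_groupAction beta k) (Defs.diagonal T k).
  by apply: (subsetP (weyl_actors_qact _ _)).
rewrite /quotient_pow_act /= qactE ?nD //.
by rewrite morphM ?nD.
Qed.

Lemma has_label_surj s : exists f : Aut, has_label (val f) s.
Proof.
have alB u v : beta (s.1.1 u) (s.1.1 v) = beta u v.
  have := label_actor s; case: (s.1) => al pi /setXP[/bichar_autP[_ alB] _].
  exact: alB.
have XAtw : twisted_basis beta (fun t => X (s.1.1 t)).
  split=> [t|u v|]; first exact: twb_unit Xtw _; last exact: twb_card Xtw.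
  by rewrite (twb_comm Xtw) alB.
have [M Mu MP] := twb_intertwiner beta_bichar beta_nondeg Xtw XAtw.
have [f fP] := acts_as_conj beta_bichar beta_nondeg Xtw (pow_ext s.2) Mu MP.
have fA := acts_as_permutes Xtw abT fP.
by exists (exist _ f fA).
Qed.

Lemma has_label_stab (f : Aut) s : has_label (val f) s ->
  (s = 1%g <-> f \in (stab : {pred Aut})).
Proof.
move=> fs.
have [H1 H2] := acts_as_stab beta_bichar beta_nondeg Xtw abT k_gt0 fs.
have ext1 : pow_ext (1%g : Tpow k.-1) = 1%g :> Tpow k.
  by apply: (mulgI (pow_ext 1%g)); rewrite -pow_extM !mulg1.
split=> [s1|/asboolP /H1[s1 s2]]; first by apply/asboolP/H2; rewrite s1 /= ext1.
apply/val_inj/injective_projections => //; apply: (pow_quo_inj abT).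
by rewrite /pow_quo s2 ext1.
Qed.

Lemma weyl_group_twisted : isomorphic (weyl_group Gamma) W.
Proof.
have [phi phiP] := choice (fun f : Aut => has_label_ex f^-1%g).
apply: (@first_isomorphism _ _ stab phi) => [f g|f|s].
- apply: has_label_uniq (phiP _) _; rewrite invgM gmulfM.
  by apply: has_labelM; apply: phiP.
- apply: (iff_trans (has_label_stab (phiP f))).
  have [s1 sF] := nsub_closed stab.
  have sV g : g \in (stab : {pred Aut}) -> g^-1%g \in (stab : {pred Aut}).
    by move=> gs; rewrite -[g^-1%g]mul1g sF.
  by split=> [/sV|]; rewrite ?invgK //; apply: sV.
have [f fs] := has_label_surj s; exists f^-1%g.
by apply: has_label_uniq (phiP _) _; rewrite invgK.
Qed.

End WeylGroup.

Theorem theorem2p8 (F : closedFieldType) (T : finGroupType)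
    (abT : abelian [set: T]) (beta : T -> T -> F)
    (beta_bichar : alternating_bicharacter beta)
    (beta_nondeg : nondegenerate_bichar beta)
    (r : nat) (l : 'I_r -> nat) (a b : 'I_r -> T)
    (ab_gen : symplectic_generators beta l a b)
    (k : nat) (k_gt0 : (0 < k)%N) :
  isomorphic (weyl_group (matrix_grading k (pauli_grading beta l a b)))
             (sdprod_by (weyl_groupAction abT beta k)).
Proof.
apply: (weyl_group_twisted beta_bichar beta_nondeg abT _ k_gt0).
exact: pauli_twisted_basis.
Qed.
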